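(* Let $M\ge 1$ be an integer. The function $q\mapsto h(\mathbf{U}_q)$ is continuous on $(1,M+1]$.
   Context: Fix an integer $M\ge 1$ and let $\Omega:=\{0,1,\dots,M\}^{\mathbb N}$. For $q\in(1,M+1]$ let $I_q:=[0,M/(q-1)]$ and $\pi_q(x_1x_2\dots):=\sum_{j\ge1}x_jq^{-j}$ for $(x_i)\in\Omega$. A $q$-expansion of $x\in I_q$ is a sequence $(x_i)\in\Omega$ with $\pi_q((x_i))=x$. The univoque set is $\mathcal U_q:=\{x\in I_q: x \text{ has exactly one } q\text{-expansion}\}$, and the symbolic univoque set is $\mathbf U_q:=\pi_q^{-1}(\mathcal U_q)\subseteq\Omega$. For $X\subseteq\Omega$, $B_k(X)$ is the set of all words of length $k$ which occur (as blocks of consecutive digits, at any position) in some sequence in $X$, and the topological entropy of $X$ is $h(X):=\lim_{k\to\infty}\frac{\log\#B_k(X)}{k}=\inf_{k\in\mathbb N}\frac{\log\#B_k(X)}{k}$ (the limit exists and equals the infimum by subadditivity). *)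

(* Defs.v *)
(* MathComp-Analysis; the real numbers are an arbitrary [R : realType]. *)
From HB Require Import structures.
From mathcomp Require Import all_boot all_order all_algebra.
From mathcomp Require Import all_classical all_reals all_analysis.

Set Implicit Arguments.
Unset Strict Implicit.
Unset Printing Implicit Defensive.

Import Order.TTheory GRing.Theory Num.Theory.
Import numFieldNormedType.Exports.

Local Open Scope classical_set_scope.
Local Open Scope ring_scope.

(* {0, 1, ..., M}^N; the digit x_(j+1) of x_1 x_2 ... is [x j]. *)
Definition Omega (M : nat) : Type := nat -> 'I_M.+1.

Definition pi_q (R : realType) (M : nat) (q : R) (x : Omega M) : R :=
  limn (series (fun j : nat => (x j)%:R / q ^+ j.+1)).

Definition I_q (R : realType) (M : nat) (q : R) : set R :=
  `[0, M%:R / (q - 1)]%classic.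

Definition q_expansion (R : realType) (M : nat) (q t : R) (x : Omega M) : Prop :=
  pi_q q x = t.

Definition univoque (R : realType) (M : nat) (q : R) : set R :=
  [set t | I_q M q t /\ exists! x : Omega M, q_expansion q t x].

Definition symbolic_univoque (R : realType) (M : nat) (q : R) : set (Omega M) :=
  @pi_q R M q @^-1` univoque M q.
Arguments symbolic_univoque {R} M q.

Definition blocks (M k : nat) (X : set (Omega M)) : {set k.-tuple 'I_M.+1} :=
  [set w : k.-tuple 'I_M.+1 |
    `[< exists x : Omega M, X x /\
          exists n : nat, forall i : 'I_k, tnth w i = x (n + i)%N >]]%SET.

(* The term of index k = 0 is 0 / 0 = 0 and does not affect the limit. *)
Definition entropy (R : realType) (M : nat) (X : set (Omega M)) : R :=
  limn (fun k : nat => ln (#|blocks k X|%:R : R) / k%:R).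
Arguments entropy R {M} X.

(* Main.v *)
Require Import Defs.
From HB Require Import structures.
From mathcomp Require Import all_boot all_order all_algebra.
From mathcomp Require Import all_classical all_reals all_analysis.
From mathcomp Require Import zify ring lra.
Import Order.TTheory GRing.Theory Num.Theory.
Import numFieldNormedType.Exports.
Local Open Scope classical_set_scope.
Local Open Scope ring_scope.

Set Implicit Arguments.
Unset Strict Implicit.
Unset Printing Implicit Defensive.

(* Call a word admissible in base q if all its suffixes and their reflections
   have finite value at most 1; for q <= M + 1 these words grow at the same
   exponential rate as the blocks of U_p, up to an arbitrarily small change of
   base. Admissibility of a word is a closed condition on q, which makes the
   growth rate upper semicontinuous; it is monotone, so only left lower
   semicontinuity remains.

   Let a be the lexicographically largest sequence all of whose prefixes are
   admissible in base q, and let b < a agree with a on m digits and continue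
   with a_m - 1, 0, 0, ... Words whose suffixes lie between the reflection of b
   and b are admissible in some base p < q. If F_n is their number, counting
   those below each shift of b gives a kneading equation F(t) D(t) = N(t) for
   F(t) = sum F_n t^n, where D is a polynomial with |D(0)| >= 1 and coefficients
   bounded by M + 4, and 0 <= N(t) <= 3 / (1 - t). Suppose that l^n bounds the
   number of words admissible in base q from below but the growth rate in every
   base p < q is less than l' < l. Then F(t) >= m on [1/l, 1/l'], so D is
   uniformly small on this interval as m grows. This is impossible: dividing D
   by Blaschke factors at many points of the interval bounds D(0). *)

(** * Words and lexicographic order *)

Section Words.
Variable M : nat.
Local Notation T := 'I_M.+1.
Implicit Types (u v w : seq T) (x y z : nat -> T) (P Q : pred (seq T)).
Local Open Scope nat_scope.

(** The sum runs by recursion on the first digit rather than over tuples, so that splitting off a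
    digit is definitional. *)
Fixpoint wsum n (f : seq T -> nat) : nat :=
  if n is n'.+1 then \sum_(d : T) wsum n' (fun w => f (d :: w)) else f [::].

Lemma leq_wsum n f g :
  (forall w, size w = n -> f w <= g w) -> wsum n f <= wsum n g.
Proof.
elim: n f g => [|n IH] f g fg /=; first exact: fg.
by apply: leq_sum => d _; apply: IH => w sw; apply: fg; rewrite /= sw.
Qed.

Lemma eq_wsum n f g :
  (forall w, size w = n -> f w = g w) -> wsum n f = wsum n g.
Proof.
by move=> fg; apply/eqP; rewrite eqn_leq !leq_wsum// => w sw; rewrite fg.
Qed.

Lemma wsumD n f g : wsum n (fun w => f w + g w) = wsum n f + wsum n g.
Proof.
elim: n f g => //= n IH f g; rewrite -big_split/=.
by apply: eq_bigr => d _; rewrite -IH.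
Qed.

Lemma wsumMl n c f : wsum n (fun w => c * f w) = c * wsum n f.
Proof.
elim: n f => //= n IH f; rewrite big_distrr/=.
by apply: eq_bigr => d _; rewrite -IH.
Qed.

Lemma wsum_cat m n f :
  wsum (m + n) f = wsum m (fun u => wsum n (fun v => f (u ++ v))).
Proof.
by elim: m f => //= m IH f; apply: eq_bigr => d _; rewrite IH.
Qed.

Lemma wsum_conj n f : wsum n (fun w => f (map (@rev_ord _) w)) = wsum n f.
Proof.
elim: n f => //= n IH f.
rewrite [RHS](reindex_inj (@rev_ord_inj _))/=.
by apply: eq_bigr => d _; exact: (IH (fun w => f (rev_ord d :: w))).
Qed.

Definition nwords n P := wsum n (fun w => P w).

Lemma leq_nwords n P Q : (forall w, size w = n -> P w -> Q w) -> nwords n P <= nwords n Q.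
Proof.
by move=> PQ; apply: leq_wsum => w sw; case: (P w) (PQ w sw) => // ->.
Qed.

Lemma eq_nwords n P Q : (forall w, size w = n -> P w = Q w) -> nwords n P = nwords n Q.
Proof. by move=> PQ; apply: eq_wsum => w /PQ ->. Qed.

Lemma nwords_eq0 n P : (forall w, size w = n -> ~~ P w) -> nwords n P = 0.
Proof.
move=> nP; rewrite /nwords (@eq_wsum _ _ (fun w => 0 * 0)) ?wsumMl// => w sw.
by rewrite (negbTE (nP w sw)).
Qed.

Lemma nwords_ex n P : 0 < nwords n P -> exists2 w, size w = n & P w.
Proof.
move=> P0; apply: contrapT => nP; move: P0.
rewrite nwords_eq0// => w sw; apply/negP => Pw; apply: nP; by exists w.
Qed.

Lemma nwords_submul m n P : (forall u v, P (u ++ v) -> P u && P v) ->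
  nwords (m + n) P <= nwords m P * nwords n P.
Proof.
move=> Pcat; rewrite /nwords wsum_cat mulnC -wsumMl; apply: leq_wsum => u _.
rewrite mulnC -wsumMl; apply: leq_wsum => v _.
by case: (P (u ++ v)) (Pcat u v) => // /(_ isT) /andP[-> ->].
Qed.

Lemma nwords_pred1 n c : nwords n (pred1 c) <= 1.
Proof.
elim: n c => [|n IH] c; first by rewrite /nwords/=; case: eqP.
case: c => [|d c]; first by rewrite nwords_eq0// => -[].
rewrite /nwords /= (bigD1 d)//= big1 ?addn0.
  apply: leq_trans (IH c); apply: leq_wsum => w _.
  by rewrite eqseq_cons eqxx.
move=> e ed; apply: (@nwords_eq0 n (fun w => pred1 (d :: c) (e :: w))) => w _.
by rewrite /= eqseq_cons (negbTE ed).
Qed.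

Lemma card_nwords n P : #|[set w : n.-tuple T | P w]%SET| = nwords n P.
Proof.
rewrite cardsE.
elim: n P => [|n IH] P.
  rewrite /nwords/=; have E (w : 0.-tuple T) : (w \in [pred w : 0.-tuple T | P w]) = P [::].
    by rewrite inE (tuple0 w).
  case: (boolP (P [::])) E => _ E.
    by rewrite (eq_card E) card_tuple expn0.
  by rewrite (eq_card E) card0.
rewrite /nwords/= -sum1_card.
rewrite (reindex (fun p : T * n.-tuple T => cons_tuple p.1 p.2)) /=; last first.
  exists (fun w : n.+1.-tuple T => (thead w, [tuple of behead w])) => /= [[d w] _|w _].
    by congr pair; apply: val_inj.
  by rewrite [RHS]tuple_eta.
rewrite (eq_bigl (fun p : T * n.-tuple T => true && P (p.1 :: p.2)))/=; last first.
  by [].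
rewrite -(pair_big_dep xpredT (fun (d : T) (w : n.-tuple T) => P (d :: w)) (fun _ _ => 1))/=.
apply: eq_bigr => d _; rewrite sum1_card.
by rewrite -[RHS](IH (fun w => P (d :: w))); apply: eq_card => w.
Qed.

(** Only nonempty suffixes are tested, so the empty word always passes. *)
Fixpoint on_suffixes P w : bool := if w is _ :: w' then P w && on_suffixes P w' else true.

Lemma on_suffixes_cat P u v : (forall u v, P (u ++ v) -> P u) ->
  on_suffixes P (u ++ v) -> on_suffixes P u && on_suffixes P v.
Proof.
move=> Pp; elim: u => //= d u IH /andP[Puv /IH /andP[-> ->]].
by rewrite (Pp (d :: u) v Puv).
Qed.

Definition pre n x : seq T := mkseq x n.
Definition sh i x : nat -> T := fun j => x (i + j).
Definition conjs x : nat -> T := fun j => rev_ord (x j).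
Local Notation cj := (map (@rev_ord M.+1)).

Lemma size_pre n x : size (pre n x) = n. Proof. exact: size_mkseq. Qed.

Lemma preS n x : pre n.+1 x = x 0 :: pre n (sh 1 x).
Proof. by rewrite /pre /mkseq /= -[1]/(1 + 0) iotaDl -map_comp. Qed.

Lemma pre_inv n x y : pre n.+1 x = pre n.+1 y ->
  x 0 = y 0 /\ pre n (sh 1 x) = pre n (sh 1 y).
Proof. by rewrite !preS => /eqP; rewrite eqseq_cons => /andP[/eqP-> /eqP->]. Qed.

Lemma preSr n x : pre n.+1 x = rcons (pre n x) (x n).
Proof. by rewrite /pre mkseqS. Qed.

Lemma sh0 x : sh 0 x = x. Proof. by []. Qed.

Lemma sh_sh i j x : sh j (sh i x) = sh (i + j) x.
Proof. by apply/funext => k; rewrite /sh addnA. Qed.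

Lemma preD m n x : pre (m + n) x = pre m x ++ pre n (sh m x).
Proof.
elim: m x => [|m IH] x; first by rewrite sh0.
by rewrite addSn !preS IH sh_sh.
Qed.

Lemma pre_conj n x : pre n (conjs x) = cj (pre n x).
Proof. by rewrite /pre /mkseq -map_comp. Qed.

Lemma conjsK : involutive conjs.
Proof. by move=> x; apply/funext => j; rewrite /conjs rev_ordK. Qed.

Lemma cjK : involutive cj.
Proof. by apply: mapK; apply: rev_ordK. Qed.

Lemma eq_pre n x y : (forall j, j < n -> x j = y j) <-> pre n x = pre n y.
Proof.
split=> [xy|e j jn]; last first.
  by have := congr1 (nth ord0 ^~ j) e; rewrite /= !nth_mkseq.
by apply/eq_in_map => j; rewrite mem_iota add0n => /andP[_]; apply: xy.
Qed.

Lemma pre_inj x y : (forall n, pre n x = pre n y) -> x = y.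
Proof.
by move=> xy; apply/funext => j; apply/(eq_pre j.+1 x y).2 => //; apply: xy.
Qed.

(** Only the first [size w] digits of [y] matter; a prefix of [y] counts as below [y]. *)
Fixpoint lexle w y : bool :=
  if w is d :: w' then (d < y 0) || (d == y 0) && lexle w' (sh 1 y) else true.

Lemma lexle_pre_refl n y : lexle (pre n y) y.
Proof. by elim: n y => // n IH y; rewrite preS /= eqxx IH orbT. Qed.

Lemma lexle_cat u v y : lexle (u ++ v) y -> lexle u y.
Proof.
by elim: u y => //= d u IH y /orP[->//|/andP[-> /IH ->]]; rewrite orbT.
Qed.

Lemma lexle_trans w y z : lexle w y -> lexle (pre (size w) y) z -> lexle w z.
Proof.
elim: w y z => [//|d w IH] y z.
rewrite [size _]/= preS /= => /orP[dy|/andP[/eqP-> wy]] /orP[yz|/andP[/eqP <- yz]].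
- by rewrite (ltn_trans dy yz).
- by rewrite dy.
- by rewrite yz.
- by rewrite eqxx (IH _ _ wy yz) orbT.
Qed.

(** Reflection reverses the order, so the second hypothesis is the opposite inequality. *)
Lemma lexle_anti w y : lexle w y -> lexle (cj w) (conjs y) -> w = pre (size w) y.
Proof.
elim: w y => [//|d w IH] y; rewrite [size _]/= preS /= {1 2}/conjs/=.
move=> /orP[dy|/andP[/eqP-> wy]]; last first.
  by rewrite ltnn eqxx/= => wy'; rewrite -(IH (sh 1 y)).
have := ltn_ord (y 0); move: dy => /= dy dM.
case/orP => [|/andP[/eqP/rev_ord_inj dE]]; first by rewrite /=; lia.
by rewrite dE ltnn in dy.
Qed.

Lemma lexleC w y : ~~ lexle w y -> lexle (cj w) (conjs y).
Proof.
elim: w y => [//|d w IH] y /=; rewrite negb_or negb_and -leqNgt => /andP[yd].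
rewrite {1 2}/conjs/= (inj_eq rev_ord_inj) => /orP[nE|/IH h].
  have {nE} : d != y 0 :> nat by [].
  have := ltn_ord d; have := ltn_ord (y 0); move: yd => /=; lia.
have [->|/eqP nE] := eqVneq d (y 0); first by rewrite h orbT.
have {nE} : nat_of_ord d <> y 0 by move/val_inj.
have := ltn_ord d; have := ltn_ord (y 0); move: yd => /=; lia.
Qed.

Lemma lexle_diff n x y : ~~ lexle (pre n x) y ->
  exists l, [/\ l < n, pre l x = pre l y & y l < x l].
Proof.
elim: n x y => [//|n IH] x y; rewrite preS /= negb_or negb_and -leqNgt.
case/andP=> yx /orP[nE|/IH[l [ln e lt]]].
  exists 0; split=> //; have {nE} : nat_of_ord (x 0) <> y 0 by move/val_inj/eqP; apply/negP.
  by move: yx => /=; lia.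
have [E|/eqP nE] := eqVneq (x 0) (y 0); first by exists l.+1; rewrite !preS E e.
exists 0; split=> //; have {nE} : nat_of_ord (x 0) <> y 0 by move/val_inj.
by move: yx => /=; lia.
Qed.

(** Within its first [l.+1] digits [y] drops strictly below [y'], hence below [z]; its later digits
    are then free, and so are those of [z]. *)
Lemma lexle_lt l y y' z z' n : pre l y = pre l y' -> y l < y' l ->
  pre l.+1 z = pre l.+1 z' -> lexle (pre l.+1 y') z -> lexle (pre n y) z'.
Proof.
elim: l y y' z z' n => [|l IH] y y' z z' [|n] //.
  move=> _ yy' /eq_pre/(_ 0 isT) zz'; rewrite !preS /= -zz'.
  by case/orP => [/(ltn_trans yy')->|/andP[/eqP<- _]] //; rewrite yy'.
move=> /pre_inv[y0 yy'] lt /pre_inv[z0 zz'].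
rewrite (preS l.+1 y') (preS n y) [lexle (_ :: _) z]/= [lexle (_ :: _) z']/= -y0 -z0.
case/orP => [->//|/andP[-> le]].
by rewrite (IH (sh 1 y) (sh 1 y') (sh 1 z)) ?orbT.
Qed.

(** Dependent choice: [Q] is an invariant of the prefixes, and [A] records how each digit was
    chosen. *)
Lemma build_seq (Q : seq T -> Prop) (A : seq T -> T -> Prop) :
  Q [::] -> (forall w, Q w -> exists2 d, Q (rcons w d) & A w d) ->
  exists x, forall n, Q (pre n x) /\ A (pre n x) (x n).
Proof.
move=> Q0 QS.
have {}QS w : exists d, Q w -> Q (rcons w d) /\ A w d.
  have [/QS[d ? ?]|nQ] := pselect (Q w); first by exists d.
  by exists ord0.
pose g w := projT1 (cid (QS w)).
have gP w : Q w -> Q (rcons w (g w)) /\ A w (g w) by exact: projT2 (cid (QS w)).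
pose p := fix p n := if n is n'.+1 then rcons (p n') (g (p n')) else [::].
have Qp n : Q (p n) by elim: n => //= n /gP[].
exists (fun n => g (p n)) => n; suff -> : pre n (fun n => g (p n)) = p n.
  by split; [exact: Qp | exact: (gP _ (Qp n)).2].
by elim: n => // n IH; rewrite preSr IH.
Qed.

(** The invariant is that the prefix built so far has continuations in [L] of every length. *)
Lemma koenig (L : pred (seq T)) w : (forall u v, L (u ++ v) -> L u && L v) ->
  (forall n, exists2 v, size v = n & L (w ++ v)) ->
  exists2 x, pre (size w) x = w & forall n, L (pre n x).
Proof.
move=> Lcat ext.
pose Q v := forall n, exists2 v', size v' = n & L (w ++ v ++ v').
have [] := @build_seq Q (fun _ _ => True).
- by move=> n; have [v sv Lv] := ext n; exists v.
- move=> v Qv; apply: contrapT => nQ.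
  have {nQ} nQ d : exists n, forall v', size v' = n -> ~~ L (w ++ v ++ d :: v').
    apply: contrapT => h; apply: nQ; exists d => // n.
    apply: contrapT => h'; apply: h; exists n => v' sv'; apply/negP => Lv'.
    by apply: h'; exists v'; rewrite // cat_rcons.
  (* If every next digit [d] dies out at length [N d], no continuation can be longer than all the
     [N d]. *)
  pose N d := projT1 (cid (nQ d)).
  have NP d v' : size v' = N d -> ~~ L (w ++ v ++ d :: v').
    exact: (projT2 (cid (nQ d)) v').
  have [[//|d v'] [sv']] := Qv (\max_(d : T) N d).+1.
  have Nd : N d <= size v' by rewrite sv'; exact: leq_bigmax.
  rewrite -(cat_take_drop (N d) v') -cat_cons !catA => /Lcat /andP[+ _].
  by rewrite -catA; apply/negP; apply: NP; rewrite size_takel.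
move=> y Qy; pose x j := if j < size w then nth ord0 w j else y (j - size w).
have xw : pre (size w) x = w.
  apply: (@eq_from_nth _ ord0); rewrite size_pre// => i iw.
  by rewrite nth_mkseq// /x iw.
have shx : sh (size w) x = y.
  by apply/funext => j; rewrite /sh /x ltnNge leq_addr/= addKn.
exists x => // n; have [[|//] _] := (Qy n).1 0.
have -> : w ++ pre n y ++ [::] = pre (n + size w) x.
  by rewrite cats0 addnC preD xw shx.
by rewrite preD => /Lcat/andP[].
Qed.

End Words.

(** * Polynomials that are small at many points *)

Section Blaschke.
Variable R : realFieldType.
Implicit Types (g u : {poly R}) (z b B e : R).

Definition l2le g B := forall N, \sum_(i < N) g`_i ^+ 2 <= B ^+ 2.

Lemma coef_XsubCM u z n : (('X - z%:P) * u)`_n.+1 = u`_n - z * u`_n.+1.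
Proof. by rewrite mulrBl coefB coefXM coefCM. Qed.

Lemma coef_1subZXM u z n : ((1 - z *: 'X) * u)`_n.+1 = u`_n.+1 - z * u`_n.
Proof. by rewrite mulrBl mul1r coefB -scalerAl coefZ coefXM. Qed.

(* On the unit circle |X - z| = |1 - z X|, so both factors change the l^2 norm
   of the coefficients in the same way. *)
Lemma l2le_blaschke z u B :
  l2le (('X - z%:P) * u) B -> l2le ((1 - z *: 'X) * u) B.
Proof.
move=> gB N; set v := (1 - _) * u.
(* The two truncated sums of squares differ by one boundary term, which vanishes once [n] reaches
   [size u]. *)
have sumE n : \sum_(i < n.+1) v`_i ^+ 2 =
    \sum_(i < n.+1) (('X - z%:P) * u)`_i ^+ 2 + (1 - z ^+ 2) * u`_n ^+ 2.
  elim: n => [|n IH].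
    rewrite !big_ord1 /v !coef0M !coefB coef1 coefZ coefX coefC /=; ring.
  rewrite big_ord_recr/= IH [in RHS]big_ord_recr/= /v coef_1subZXM coef_XsubCM.
  ring.
apply: le_trans (gB (maxn N (size u)).+1).
have := sumE (maxn N (size u)).
rewrite (nth_default 0 (leq_maxr N (size u))) expr0n mulr0 addr0 => <-.
have -> : (maxn N (size u)).+1 = (N + ((maxn N (size u)).+1 - N))%N by lia.
rewrite big_split_ord/= lerDl.
by apply: sumr_ge0 => i _; exact: sqr_ge0.
Qed.

Lemma l2le_subC g B c : 0 <= B -> l2le g B -> l2le (g - c%:P) (B + `|c|).
Proof.
move=> B0 gB [|N]; first by rewrite big_ord0 sqr_ge0.
have g0B : `|g`_0| <= B.
  have := gB 1%N; rewrite big_ord1 -[leLHS]real_normK ?num_real//.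
  by rewrite ler_sqr.
have := gB N.+1; rewrite !big_ord_recl coefB coefC eqxx.
rewrite [in X in _ -> X](eq_bigr (fun i => g`_(lift ord0 i) ^+ 2)); last first.
  by move=> i _; rewrite coefB coefC/= subr0.
rewrite [nat_of_ord _]/=; set S := \sum_(i < N) _ => le1.
have : - (g`_0 * c) <= B * `|c|.
  apply: le_trans (ler_norm _) _; rewrite normrN normrM ler_wpM2r//.
have := real_normK (num_real c).
nra.
Qed.

(** Induction on the points: write g - g(z) = (X - z) u and pass to v = (1 - z X) u. The l^2 bound
    survives up to [e], v is still O(e) at the other points, and g_0 = g(z) - z v_0 gains a factor z
    <= b. The constant [C] depends on the points only, not on [g]. *)
Lemma coef0_le_at_points b zs : 0 <= b -> uniq zs -> {in zs, forall z, 0 <= z <= b} ->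
  exists2 C, 0 <= C & forall g B e, 0 <= B -> 0 <= e -> l2le g B ->
    {in zs, forall z, `|g.[z]| <= e} -> `|g`_0| <= b ^+ size zs * B + C * e.
Proof.
move=> b0; elim: zs => [_ _|z zs IH /andP[zzs uzs] zb].
  exists 0 => // g B e B0 e0 gB _; rewrite expr0 mul1r mul0r addr0.
  have := gB 1%N; rewrite big_ord1 -[leLHS]real_normK ?num_real//.
  by rewrite ler_sqr.
have [|C C0 HC] := IH uzs.
  by move=> w wzs; apply: zb; rewrite inE wzs orbT.
have /andP[z0 zb'] : 0 <= z <= b by apply: zb; rewrite inE eqxx.
(* The summand at [w] dominates 2 |1 - z w| / |w - z|, so |v| <= [K * e] at the remaining points. *)
pose K := \sum_(w <- zs) 2 * ((1 + b * b) / `|w - z|).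
have K0 : 0 <= K.
  by apply: sumr_ge0 => w _; rewrite mulr_ge0// divr_ge0// addr_ge0// mulr_ge0.
exists (1 + b * C * K + b ^+ (size zs).+1) => [|g B e B0 e0 gB ge].
  by rewrite !addr_ge0// ?mulr_ge0 ?exprn_ge0.
set d := g.[z].
have de : `|d| <= e by apply: ge; rewrite inE eqxx.
have /factor_theorem[u gE] : root (g - d%:P) z.
  by rewrite rootE hornerD hornerN hornerC subrr.
rewrite mulrC in gE.
pose v := (1 - z *: 'X) * u.
have vB : l2le v (B + e).
  apply: l2le_blaschke; rewrite -gE => N; apply: le_trans (l2le_subC d B0 gB N) _.
  by rewrite ler_sqr ?nnegrE ?addr_ge0// lerD2l.
have ve : {in zs, forall w, `|v.[w]| <= K * e}.
  move=> w wzs.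
  have wz : w - z != 0.
    by rewrite subr_eq0; apply: contra zzs => /eqP <-.
  have /andP[w0 wb] : 0 <= w <= b by apply: zb; rewrite inE wzs orbT.
  have uw : u.[w] = (g.[w] - d) / (w - z).
    have := congr1 (fun p : {poly R} => p.[w]) gE.
    rewrite hornerM !hornerE => ->.
    by rewrite mulrC mulKf.
  rewrite /v hornerM uw !hornerE normrM normrM normfV.
  have gd : `|g.[w] - d| <= 2 * e.
    apply: le_trans (ler_normB _ _) _; rewrite mulr_natl mulr2n lerD//.
    by apply: ge; rewrite inE wzs orbT.
  have zw : `|1 - z * w| <= 1 + b * b.
    apply: le_trans (ler_normB _ _) _; rewrite normr1 lerD2l ger0_norm ?mulr_ge0//.
    exact: ler_pM.
  apply: le_trans (_ : (1 + b * b) * (2 * e / `|w - z|) <= _).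
    rewrite -mulrA; apply: ler_pM => //.
    by rewrite ler_wpM2r ?invr_ge0.
  rewrite (_ : _ * _ = 2 * ((1 + b * b) / `|w - z|) * e); last by ring.
  rewrite ler_wpM2r// /K (big_rem w)//= lerDl; apply: sumr_ge0 => x _.
  by rewrite mulr_ge0// divr_ge0// addr_ge0// mulr_ge0.
have v0 : `|v`_0| <= b ^+ size zs * (B + e) + C * (K * e).
  by apply: HC; rewrite ?addr_ge0 ?mulr_ge0.
have g0 : g`_0 = d - z * v`_0.
  have := congr1 (fun p : {poly R} => p`_0) gE.
  rewrite /v !coef0M !coefB !(coefC, coefZ, coefX, coef1) !eqxx [(0 == 1)%N]/= => h.
  rewrite /= in h *; lra.
rewrite g0; apply: le_trans (ler_normB _ _) _.
have : `|z * v`_0| <= b * (b ^+ size zs * (B + e) + C * (K * e)).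
  by rewrite normrM (ger0_norm z0) ler_pM.
rewrite /= exprS; move: (b ^+ size zs) => bb.
nra.
Qed.

End Blaschke.

(** * Counting words between b and its reflection *)

Section Counting.
Variable M : nat.
Local Notation T := 'I_M.+1.
Local Notation cj := (map (@rev_ord M.+1)).
Implicit Types (u v w : seq T) (x y z : nat -> T) (P Q : pred (seq T)).
Local Open Scope nat_scope.

(** The lower bound, the reflection of [b], is expressed as an upper bound for the reflected
    word. *)
Definition within_lex b w := lexle w b && lexle (cj w) b.
Definition nW b n := nwords n (on_suffixes (within_lex b)).
Definition nC b n y := nwords n (fun w => on_suffixes (within_lex b) w && lexle w y).

Lemma within_lex_cj b w : within_lex b (cj w) = within_lex b w.
Proof. by rewrite /within_lex cjK andbC. Qed.

Lemma on_suffixes_cj P w : (forall v, P (cj v) = P v) -> on_suffixes P (cj w) = on_suffixes P w.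
Proof. by move=> Pcj; elim: w => //= d w ->; rewrite -Pcj /= -/cj rev_ordK cjK. Qed.

Lemma within_lex_cat b u v : within_lex b (u ++ v) -> within_lex b u.
Proof. by rewrite /within_lex map_cat => /andP[/lexle_cat-> /lexle_cat->]. Qed.

Lemma nW_submul b m n : nW b (m + n) <= nW b m * nW b n.
Proof. by apply: nwords_submul => u v; apply: on_suffixes_cat; exact: within_lex_cat. Qed.

Lemma nC_le b n y : nC b n y <= nW b n.
Proof. by apply: leq_nwords => w _ /andP[]. Qed.

Lemma nC_b b n : nC b n b = nW b n.
Proof.
apply: eq_nwords => w _; apply: andb_idr.
by case: w => // d w /andP[/andP[]].
Qed.

Lemma sum_ltn_ord n k : k <= n -> \sum_(d < n) (d < k) = k.
Proof.
move=> kn; rewrite -[RHS](card_ord k) -sum1_card.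
rewrite (big_ord_widen n (fun=> 1) kn) [RHS]big_mkcond/=.
by apply: eq_bigr => d _; case: ltnP.
Qed.

(** Each of the [y 0] smaller first digits leaves [w] unrestricted; the digit [y 0] itself passes
    the comparison on to the shift. *)
Lemma sum_nwords_lexle P n y :
  \sum_(d : T) nwords n (fun w => P w && lexle (d :: w) y) =
  y 0 * nwords n P + nwords n (fun w => P w && lexle w (sh 1 y)).
Proof.
rewrite -[X in X * _](@sum_ltn_ord M.+1 (y 0)); last by rewrite ltnW// ltn_ord.
rewrite big_distrl/= -[X in _ + X]mul1n.
have -> : 1 = \sum_(d : T) (d == y 0).
  by rewrite (bigD1 (y 0))//= eqxx big1// => d /negbTE->.
rewrite big_distrl -big_split/=; apply: eq_bigr => d _.
rewrite /nwords -!wsumMl -wsumD; apply: eq_wsum => w _.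
have [->|dy] := eqVneq d (y 0); first by rewrite ltnn mul1n.
by case: (P w); case: ltnP => _ /=; rewrite ?mul0n ?muln0.
Qed.

(* Words d :: w of W are counted, for fixed w in W, as those with d :: w <= y
   minus those with d :: w below the lower bound; the latter are counted by conjugation. *)
Lemma nC_rec b n y :
  (forall w, lexle w y -> lexle w b) -> (forall w, ~~ lexle (cj w) b -> lexle w y) ->
  nC b n.+1 y + M.+1 * nW b n =
  (y 0 + b 0) * nW b n + nC b n (sh 1 y) + nC b n (sh 1 b).
Proof.
move=> yb by_; set P := on_suffixes (within_lex b).
have E1 : nC b n.+1 y + \sum_(d : T) nwords n (fun w => P w && ~~ lexle (cj (d :: w)) b) =
    \sum_(d : T) nwords n (fun w => P w && lexle (d :: w) y).
  rewrite {1}/nC /nwords [X in X + _]/= -big_split; apply: eq_bigr => d _.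
  rewrite /= /nwords -wsumD; apply: eq_wsum => w _.
  have boolE (p lb lc ly : bool) : (ly -> lb) -> (~~ lc -> ly) ->
      ((lb && lc && p) && ly + (p && ~~ lc) = (p && ly))%N.
    by case: p; case: lb; case: lc; case: ly => //= h1 h2; do [have := h1 isT | have := h2 isT].
  exact: boolE (yb (d :: w)) (by_ (d :: w)).
have E2 : \sum_(d : T) nwords n (fun w => P w && lexle (cj (d :: w)) b) =
    b 0 * nW b n + nC b n (sh 1 b).
  rewrite -sum_nwords_lexle [RHS](reindex_inj (@rev_ord_inj _))/=.
  apply: eq_bigr => d _; rewrite /nwords -[RHS]wsum_conj; apply: eq_wsum => w _.
  by rewrite /P /= on_suffixes_cj//; exact: within_lex_cj.
have E3 : \sum_(d : T) nwords n (fun w => P w && lexle (cj (d :: w)) b) +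
    \sum_(d : T) nwords n (fun w => P w && ~~ lexle (cj (d :: w)) b) = M.+1 * nW b n.
  rewrite -big_split -[X in X * _](card_ord M.+1) -sum_nat_const.
  apply: eq_bigr => d _; rewrite /= /nwords -wsumD; apply: eq_wsum => w _.
  by rewrite -/P; case: (P w); case: (_ || _).
rewrite sum_nwords_lexle in E1; rewrite -/P -/(nW b n) -/(nC b n (sh 1 y)) in E1.
lia.
Qed.

(** Twice the recursion at [y] minus the recursion at [b] eliminates the count below [sh 1 b]. *)
Lemma nC_double b n y :
  (forall w, lexle w y -> lexle w b) -> (forall w, ~~ lexle (cj w) b -> lexle w y) ->
  (forall w, ~~ lexle (cj w) b -> lexle w b) ->
  2 * nC b n.+1 y + M.+1 * nW b n =
  nW b n.+1 + 2 * (y 0) * nW b n + 2 * nC b n (sh 1 y).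
Proof.
move=> yb by_ bb; have := nC_rec n yb by_.
have := nC_rec n (fun w h => h) bb; rewrite nC_b; lia.
Qed.

(** A counted word lies both below and above the reflection of [b], so it is a prefix of it. *)
Lemma nC_le1 b n y : (forall n, lexle (pre n y) (conjs b)) -> nC b n y <= 1.
Proof.
move=> yb; apply: leq_trans (nwords_pred1 n (pre n (conjs b))).
apply: leq_nwords => w sw /andP[Pw wy]; rewrite /= -{1}sw; apply/eqP.
apply: lexle_anti; first exact: lexle_trans wy (yb _).
by rewrite conjsK; case: w {sw wy} Pw => //= d w /andP[/andP[]].
Qed.

Lemma lexle_ord_max n y j :
  lexle (pre n (fun=> ord_max)) y -> j < n -> y j = ord_max.
Proof.
elim: n y j => [//|n IH] y j; rewrite preS [lexle _ y]/=.
case/orP => [|/andP[/eqP y0 /IH h]]; first by rewrite ltnNge -ltnS ltn_ord.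
by case: j => [|j]; [rewrite y0 | exact: h].
Qed.

End Counting.

(** * A sequence just below a shift-maximal one *)

Section LowerNeighbour.
Variables (M : nat) (a : nat -> 'I_M.+1) (m : nat).
Local Notation T := 'I_M.+1.
Local Notation cj := (map (@rev_ord M.+1)).
Hypothesis M_gt0 : (0 < M)%N.
Hypothesis am : (0 < a m)%N.
Hypothesis a_max : forall i n, lexle (pre n (sh i a)) a.
Local Open Scope nat_scope.

(** The zero tail keeps all prefix values below that of the first [m.+1] digits, and forces some
    shift of [b] below the reflection of [b]. *)
Definition lower_seq : nat -> T := fun j =>
  if j < m then a j else if j == m then inord (a m).-1 else ord0.
Local Notation b := lower_seq.

Lemma lower_seq_lt j : j < m -> b j = a j.
Proof. by rewrite /lower_seq => ->. Qed.

Lemma lower_seq_at : b m = (a m).-1 :> nat.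
Proof.
rewrite /lower_seq ltnn eqxx inordK// ltnS.
by rewrite (leq_trans (leq_pred _))// -ltnS.
Qed.

Lemma lower_seq_gt j : m < j -> b j = ord0.
Proof. by move=> mj; rewrite /lower_seq ltnNge ltnW//= gtn_eqF. Qed.

(** For 0 < i <= m the shift of [b] drops below that of [a] at position m - i; the latter is at most
    [a], which agrees with [b] that far. *)
Lemma lower_seq_max i n : i <= m -> lexle (pre n (sh i b)) b.
Proof.
case: i => [_|i im]; first exact: lexle_pre_refl.
apply: (@lexle_lt _ (m - i.+1) _ (sh i.+1 a) a).
- by apply/eq_pre => j jm; rewrite /sh lower_seq_lt//; lia.
- by rewrite /sh subnKC// lower_seq_at; lia.
- by apply/eq_pre => j jm; rewrite lower_seq_lt//; lia.
- exact: a_max.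
Qed.

(** [k] is the first shift at which [b] fails to lie above its own reflection; the zero tail, at
    shift [m.+1], is such a failure. *)
Lemma lower_seq_cut : exists k, [/\ k <= m.+1,
  forall i n, i < k -> lexle (cj (pre n (sh i b))) b &
  forall n, lexle (pre n (sh k b)) (conjs b)].
Proof.
pose bad i := `[< exists n, ~~ lexle (cj (pre n (sh i b))) b >].
have bad_m : bad m.+1.
  (* With [m.+2] digits the comparison reaches position [m.+1], where [b] is 0 but would have to be
     [M]. *)
  apply/asboolP; exists m.+2; apply/negP.
  rewrite -pre_conj (_ : conjs _ = fun=> ord_max); last first.
    apply/funext => j; rewrite /conjs /sh lower_seq_gt ?leq_addr//.
    by apply: val_inj => /=; lia.
  move=> /lexle_ord_max/(_ (ltnSn _)); rewrite lower_seq_gt// => /(congr1 val)/=.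
  by move: M_gt0; lia.
case: (ex_minnP (ex_intro bad _ bad_m)) => k /asboolP[n0 badk] kmin; exists k; split.
- exact: kmin.
- move=> i n ik; apply: contrapT => /negP bi.
  have := kmin i; rewrite leqNgt ik => /(_ _)/negP; apply => //.
  by apply/asboolP; exists n.
- move=> n; apply: contrapT => /negP nle.
  (* The longer prefix also covers the length [n0] at which [badk] holds, and so contradicts it. *)
  have nle' : ~~ lexle (pre (n + n0) (sh k b)) (conjs b).
    by apply: contra nle; rewrite preD => /lexle_cat.
  move: (lexleC nle'); rewrite conjsK addnC preD map_cat => /lexle_cat.
  by apply/negP.
Qed.

(** The recursions for the shifts of [b] form a finite system: at shift [k] at most one word is
    left. *)
Lemma nC_lower_seq : exists k, [/\ k <= m.+1,
  forall i n, i < k -> 2 * nC b n.+1 (sh i b) + M.+1 * nW b n =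
    nW b n.+1 + 2 * (b i) * nW b n + 2 * nC b n (sh i.+1 b) &
  forall n, nC b n (sh k b) <= 1].
Proof.
have [k [km kmin kbad]] := lower_seq_cut; exists k; split => //; last first.
  by move=> n; apply: nC_le1 => ?; exact: kbad.
have lower i : i < k -> forall w, ~~ lexle (cj w) b -> lexle w (sh i b).
  move=> ik w; apply: contraNT => /lexleC h; apply: lexle_trans h _.
  by rewrite pre_conj; apply: kmin.
move=> i n ik; have -> : b i = sh i b 0 by rewrite /sh addn0.
rewrite -[i.+1]addn1 -sh_sh; apply: nC_double.
- by move=> w h; apply: lexle_trans h _; apply: lower_seq_max; lia.
- exact: lower.
- by have := lower 0; rewrite sh0; apply; lia.
Qed.

End LowerNeighbour.

(** * The kneading equation *)

Section Growth.
Variable R : realType.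
Implicit Types (t r : R).

Lemma one_sub_le_exp n e : 0 <= e <= 1 -> 1 - n%:R * e <= (1 - e) ^+ n :> R.
Proof.
move=> /andP[e0 e1]; elim: n => [|n IH]; first by rewrite mul0r subr0 expr0.
rewrite exprSr; apply: le_trans (_ : (1 - n%:R * e) * (1 - e) <= _); last first.
  by rewrite ler_wpM2r// subr_ge0.
rewrite -natr1; have : 0 <= n%:R * (e * e) by rewrite !mulr_ge0.
lra.
Qed.

(** Fekete's argument: one length [N] with a count below r^N bounds all counts by a smaller rate,
    with [C] absorbing the remainders modulo [N]. *)
Lemma submul_growth (W : nat -> nat) r N :
  (forall m n, (W (m + n) <= W m * W n)%N) -> 0 < r -> (W N)%:R < r ^+ N ->
  exists mu C : R, [/\ 0 < mu, mu < r, 0 <= C & forall n, (W n)%:R <= C * mu ^+ n].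
Proof.
move=> Wsub r0 WN.
case: N WN => [|N] WN.
  have W0 : W 0%N = 0%N by move: WN; rewrite expr0 ltrn1; case: (W 0%N).
  exists (r / 2), 0; split => //; [lra|lra|move=> n].
  have := Wsub 0%N n; rewrite W0 mul0n add0n leqn0 => /eqP->.
  by rewrite mul0r.
set N1 := N.+1 in WN *.
have rN0 : 0 < r ^+ N1 by rewrite exprn_gt0.
pose x := (W N1)%:R / r ^+ N1.
have x0 : 0 <= x by rewrite divr_ge0// ltW.
have x1 : x < 1 by rewrite ltr_pdivrMr// mul1r.
have N10 : 1 <= N1%:R :> R by rewrite ler1n.
(* With this [e], Bernoulli gives (1 - e)^N >= (1 + x) / 2 >= x, hence W(N) = r^N x <= mu^N. *)
pose e := (1 - x) / (2 * N1%:R).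
have eE : N1%:R * e = (1 - x) / 2.
  by rewrite /e; field; rewrite pnatr_eq0.
have e0 : 0 < e by rewrite divr_gt0 ?mulr_gt0 ?subr_gt0//; lra.
have e1 : e <= 1 / 2 by nra.
pose mu := r * (1 - e).
have mu0 : 0 < mu by rewrite mulr_gt0//; lra.
have WNmu : (W N1)%:R <= mu ^+ N1.
  have -> : (W N1)%:R = r ^+ N1 * x by rewrite /x mulrC divfK// gt_eqF.
  rewrite /mu exprMn; apply: ler_wpM2l; first exact: ltW.
  apply: le_trans _ (one_sub_le_exp N1 _); first by rewrite eE; lra.
  by rewrite ltW//=; lra.
pose C := \sum_(j < N1) (W j)%:R / mu ^+ j.
exists mu, C; split => //.
- by rewrite /mu; nra.
- by apply: sumr_ge0 => j _; rewrite divr_ge0// exprn_ge0// ltW.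
move=> n; rewrite (divn_eq n N1); have := ltn_pmod n (isT : (0 < N1)%N).
move: (n %/ N1)%N (n %% N1)%N => k j jN.
have Ck : (W (k * N1 + j)%N)%:R <= (mu ^+ N1) ^+ k * (W j)%:R.
  elim: k => [|k IH]; first by rewrite expr0 mul1r.
  rewrite mulSn -addnA; apply: le_trans (_ : (W N1 * W (k * N1 + j)%N)%N%:R <= _).
    by rewrite ler_nat.
  by rewrite natrM exprS -mulrA ler_pM.
apply: le_trans Ck _.
have -> : mu ^+ (k * N1 + j) = (mu ^+ N1) ^+ k * mu ^+ j by rewrite exprD mulnC exprM.
rewrite mulrCA; apply: ler_wpM2l; first by rewrite !exprn_ge0// ltW.
rewrite -ler_pdivrMr ?exprn_gt0// /C (bigD1 (Ordinal jN))//= lerDl.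
by apply: sumr_ge0 => i _; rewrite divr_ge0// exprn_ge0// ltW.
Qed.

Lemma geometric_bounded r C : (forall n, r ^+ n <= C) -> r <= 1.
Proof.
move=> rC; rewrite leNgt; apply/negP => r1.
have h n : 1 + n%:R * (r - 1) <= r ^+ n.
  elim: n => [|n IH]; first by rewrite mul0r addr0 expr0.
  rewrite exprSr; apply: le_trans (_ : (1 + n%:R * (r - 1)) * r <= _); last first.
    by rewrite ler_wpM2r//; lra.
  rewrite -natr1; have : 0 <= n%:R * ((r - 1) * (r - 1)).
    by rewrite !mulr_ge0// subr_ge0 ltW.
  lra.
have p0 : 0 < (`|C| + 1) / (r - 1) by rewrite divr_gt0 ?subr_gt0// ltr_wpDl.
have := archi_boundP (ltW p0); set n := Num.bound _.
rewrite ltr_pdivrMr ?subr_gt0// => hn.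
have := rC n; have := h n; have := ler_norm C; lra.
Qed.

Lemma sum_geometric_le t k : 0 <= t -> t < 1 -> \sum_(i < k) t ^+ i <= (1 - t)^-1.
Proof.
move=> t0 t1; rewrite -[leRHS]mul1r ler_pdivlMr ?subr_gt0//.
have := subrX1 t k; rewrite mulrC; have := exprn_ge0 k t0.
move: (\sum_(i < k) t ^+ i) => S; lra.
Qed.

End Growth.

(** * The kneading polynomial and its bounds *)

Section KneadingPolynomial.
Variable R : realType.
Variables (M k : nat) (d : nat -> nat) (W : nat -> nat) (c : nat -> nat -> nat).
Hypothesis c0 : forall n, c 0%N n = W n.
Hypothesis ci0 : forall i, c i 0%N = 1%N.
Hypothesis cW : forall i n, (c i n <= W n)%N.
Hypothesis c_rec : forall i n, (i < k)%N ->
  (2 * c i n.+1 + M.+1 * W n = W n.+1 + 2 * d i * W n + 2 * c i.+1 n)%N.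
Hypothesis ck : forall n, (c k n <= 1)%N.

(** This is the factor of the generating function of [W] left after substituting the [k] recursions
    into each other. *)
Definition kneading_poly : {poly R} :=
  2%:P - \sum_(i < k) ('X^i + (2 * (d i)%:R - M.+1%:R : R) *: 'X^(i.+1)).
Local Notation D := kneading_poly.

Lemma kneading_poly0 : 1 <= `|D`_0|.
Proof.
rewrite coefB coefC eqxx coef_sum.
case: k => [|k']; first by rewrite big_ord0 subr0 ger0_norm; lra.
rewrite big_ord_recl big1 => [|i _]; rewrite coefD coefZ !coefXn/= !mulr0 addr0//.
by rewrite addr0 ger0_norm; lra.
Qed.

(** A power of X meets at most one summand X^i and one X^(i+1), contributing 1 and M + 1; the
    constant adds 2. *)
Lemma kneading_poly_coef j : (forall i, (d i <= M)%N) -> `|D`_j| <= M%:R + 4.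
Proof.
move=> dM; rewrite coefB coefC coef_sum.
have : `|\sum_(i < k) ('X^i + (2 * (d i)%:R - M.+1%:R : R) *: 'X^(i.+1))`_j| <= M%:R + 2.
  rewrite (eq_bigr (fun i : 'I_k => (j == i)%:R +
      (2 * (d i)%:R - M.+1%:R) * (j == i.+1)%:R)); last first.
    by move=> i _; rewrite coefD coefZ !coefXn.
  rewrite big_split/=.
  have s1 : `|\sum_(i < k) (j == i)%:R : R| <= 1.
    have [jk|kj] := ltnP j k.
      rewrite (bigD1 (Ordinal jk))//= eqxx big1 ?addr0 ?normr1// => i ij.
      by move: ij; rewrite -(inj_eq val_inj)/= eq_sym => /negbTE->.
    rewrite big1 ?normr0// => i _; case: eqP => // ji.
    by have := ltn_ord i; rewrite -ji ltnNge kj.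
  have s2 : `|\sum_(i < k) (2 * (d i)%:R - M.+1%:R) * (j == i.+1)%:R : R| <= M%:R + 1.
    case: j {s1} => [|j]; first by rewrite big1 ?normr0 => [|i _]; rewrite ?mulr0// addr_ge0.
    have [jk|kj] := ltnP j k.
      rewrite (bigD1 (Ordinal jk))//= eqxx mulr1 big1 ?addr0 => [|i ij].
        have : (d j)%:R <= M%:R :> R by rewrite ler_nat.
        have : 0 <= (d j)%:R :> R by [].
        rewrite -natr1 ler_norml => *; apply/andP; split; lra.
      by move: ij; rewrite -(inj_eq val_inj)/= eqSS eq_sym => /negbTE->; rewrite mulr0.
    rewrite big1 ?normr0 ?addr_ge0// => i _; rewrite eqSS; case: eqP => [ji|]; rewrite ?mulr0//.
    by have := ltn_ord i; rewrite -ji ltnNge kj.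
  apply: le_trans (ler_normD _ _) _; lra.
move: (\sum_(i < k) _) => S hS; apply: le_trans (ler_normB _ _) _.
have : `|(if j == 0%N then 2 else 0 : R)| <= 2.
  by case: eqP => _; rewrite ?normr0// ger0_norm.
lra.
Qed.

Section AtPoint.
Variable t : R.
Hypothesis t01 : 0 < t < 1.
Let s (f : nat -> nat) : R^nat := series (fun n => (f n)%:R * t ^+ n).
Hypothesis W_cvg : cvgn (s W).

Let t_ge0 : 0 <= t. Proof. by case/andP: t01 => /ltW. Qed.

Let G i := limn (s (c i)).

Let s_ge0 f n : 0 <= (f n)%:R * t ^+ n :> R.
Proof. by rewrite mulr_ge0 ?exprn_ge0. Qed.

Let c_cvg i : s (c i) @ \oo --> G i.
Proof.
apply: (@series_le_cvg R) W_cvg => // n; do ?exact: s_ge0.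
by rewrite ler_wpM2r ?exprn_ge0// ler_nat.
Qed.

Let G0 : G 0 = limn (s W).
Proof. by rewrite /G; congr (limn (s _)); apply/funext. Qed.

(** The recursion multiplied by t^(n+1) and summed over n; the 1 comes from the terms of index 0. It
    is proved for partial sums and passed to the limit. *)
Let G_rec i : (i < k)%N ->
  2 * G i = 1 + G 0 + (2 * (d i)%:R - M.+1%:R) * t * G 0 + 2 * t * G i.+1.
Proof.
move=> ik.
have sS f N : s f N.+1 = s f N + (f N)%:R * t ^+ N by rewrite /s seriesSr.
have s0 f : s f 0%N = 0 by rewrite /s /series/= big_geq.
have E N : 2 * s (c i) N.+1 = 1 + s (c 0%N) N.+1 +
    (2 * (d i)%:R - M.+1%:R) * t * s (c 0%N) N + 2 * t * s (c i.+1) N.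
  elim: N => [|N IH]; first by rewrite !sS !s0 !ci0 expr0; ring.
  have := congr1 (fun n => n%:R : R) (c_rec N ik).
  rewrite !natrD !natrM => h.
  have {}h : (W N.+1)%:R = 2 * (c i N.+1)%:R + M.+1%:R * (W N)%:R
      - 2 * (d i)%:R * (W N)%:R - 2 * (c i.+1 N)%:R :> R by lra.
  rewrite sS mulrDr IH !sS !c0 h exprS; ring.
have sS_cvg j : (fun N => s (c j) N.+1) @ \oo --> G j.
  by rewrite (cvg_shiftS (s (c j))); exact: c_cvg.
have l1 : (fun N => 2 * s (c i) N.+1) @ \oo --> 2 * G i.
  by apply: cvgMr; exact: sS_cvg.
have l2 : (fun N => 2 * s (c i) N.+1) @ \oo -->
    1 + G 0 + (2 * (d i)%:R - M.+1%:R) * t * G 0 + 2 * t * G i.+1.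
  rewrite (funext E); apply: cvgD; last by apply: cvgMr; exact: c_cvg.
  apply: cvgD; last by apply: cvgMr; exact: c_cvg.
  apply: cvgD; first exact: cvg_cst.
  exact: sS_cvg.
exact: (cvg_unique _ l1 l2).
Qed.

Let G_iter j : (j <= k)%N ->
  2 * G 0 = G 0 * (\sum_(i < j) (t ^+ i + (2 * (d i)%:R - M.+1%:R) * t ^+ i.+1)) +
    \sum_(i < j) t ^+ i + 2 * t ^+ j * G j.
Proof.
elim: j => [_|j IH jk]; first by rewrite !big_ord0 expr0; ring.
rewrite {1}(IH (ltnW jk)) !big_ord_recr/= mulrAC (G_rec jk) exprS.
ring.
Qed.

(** The iterated recursion reads D(t) G_0 = sum_(i < k) t^i + 2 t^k G_k, and both the geometric sum
    and G_k are at most 1 / (1 - t). *)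
Lemma kneading_bound : `|D.[t]| * limn (s W) <= 3 / (1 - t).
Proof.
have /andP[t0 t1] := t01.
have Gk0 : 0 <= G k.
  apply: limr_ge; first by apply/cvg_ex; exists (G k); exact: c_cvg.
  by near=> N; rewrite /s /series/=; apply: sumr_ge0.
have Gk1 : G k <= (1 - t)^-1.
  apply: limr_le; first by apply/cvg_ex; exists (G k); exact: c_cvg.
  near=> N; rewrite /s /series/= big_mkord.
  apply: le_trans (sum_geometric_le N t_ge0 t1); apply: ler_sum => i _.
  by rewrite -[leRHS]mul1r ler_wpM2r ?exprn_ge0// lern1.
have W0 : 0 <= limn (s W).
  by apply: limr_ge => //; near=> N; rewrite /s /series/=; apply: sumr_ge0.
have Sk := sum_geometric_le k t_ge0 t1.
have Sk0 : 0 <= \sum_(i < k) t ^+ i by apply: sumr_ge0 => i _; exact: exprn_ge0.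
have tk0 : 0 <= t ^+ k by exact: exprn_ge0.
have tk1 : t ^+ k <= 1 by rewrite exprn_ile1// ltW.
have DE : D.[t] = 2 - \sum_(i < k) (t ^+ i + (2 * (d i)%:R - M.+1%:R) * t ^+ i.+1).
  rewrite /D hornerD hornerN hornerC horner_sum; congr (_ - _).
  by apply: eq_bigr => i _; rewrite hornerD hornerZ !hornerXn.
have E := G_iter (leqnn k).
rewrite -[X in _ * X](ger0_norm W0) -normrM DE -G0.
rewrite (_ : _ * _ = \sum_(i < k) t ^+ i + 2 * t ^+ k * G k); last by lra.
rewrite ger0_norm ?addr_ge0 ?mulr_ge0//.
move: (\sum_(i < k) t ^+ i) (t ^+ k) (G k) Sk Sk0 tk0 tk1 Gk0 Gk1 => S x g.
move=> *; nra.
Unshelve. all: by end_near. Qed.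

End AtPoint.
End KneadingPolynomial.

(** * Persistence of growth from finitely many lengths *)

Section GrowthPersistence.
Variable R : realType.
Implicit Types (x e t l : R).

Lemma exists_exp_lt x e : 0 < x < 1 -> 0 < e -> exists n, x ^+ n < e.
Proof.
move=> /andP[x0 x1] e0; apply: contrapT => nex.
have : x^-1 <= 1.
  apply: (@geometric_bounded _ _ e^-1) => n.
  rewrite exprVn lef_pV2 ?posrE ?exprn_gt0// leNgt; apply/negP => h.
  by apply: nex; exists n.
by rewrite invf_le1// leNgt x1.
Qed.

Lemma exists_points m (a b : R) : 0 <= a < b ->
  exists zs, [/\ size zs = m, uniq zs & {in zs, forall z, a <= z <= b}].
Proof.
move=> /andP[a0 ab].
exists [seq a + (b - a) / i.+1%:R | i <- iota 0 m]; split.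
- by rewrite size_map size_iota.
- rewrite map_inj_uniq ?iota_uniq// => i j /addrI/(mulfI _).
  rewrite subr_eq0 gt_eqF// => /(_ isT)/invr_inj/eqP.
  by rewrite eqr_nat eqSS => /eqP.
move=> _ /mapP[i _ ->].
have i1 : 1 <= i.+1%:R :> R by rewrite ler1n.
have : 0 <= (b - a) / i.+1%:R by rewrite divr_ge0// subr_ge0 ltW.
have : (b - a) / i.+1%:R <= b - a.
  by rewrite ler_pdivrMr ?ltr0n// ler_peMr// subr_ge0 ltW.
move: (_ / _) => x h1 h2; apply/andP; split; lra.
Qed.

(** Rescaling by a factor below 1 turns bounded coefficients into square-summable ones. *)
Lemma poly_rescale (D : {poly R}) x : exists g : {poly R},
  (forall i, g`_i = D`_i * x ^+ i) /\ forall z, g.[z] = D.[x * z].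
Proof.
exists (\poly_(i < size D) (D`_i * x ^+ i)); split => [i|z].
  by rewrite coef_poly; case: ltnP => // h; rewrite nth_default ?mul0r.
rewrite horner_poly horner_coef; apply: eq_bigr => i _.
by rewrite exprMn mulrA.
Qed.

(** The threshold [m0] depends on [M], [l] and [l'] only, so it can be fixed before the sequence [b]
    is chosen. *)
Lemma growth_persist (M : nat) l l' : 1 < l' < l -> exists m0 : nat,
  forall (k : nat) (d W : nat -> nat) (c : nat -> nat -> nat),
  (forall n, c 0%N n = W n) -> (forall i, c i 0%N = 1%N) ->
  (forall i n, (c i n <= W n)%N) ->
  (forall i n, (i < k)%N ->
    (2 * c i n.+1 + M.+1 * W n = W n.+1 + 2 * d i * W n + 2 * c i.+1 n)%N) ->
  (forall n, (c k n <= 1)%N) -> (forall i, (d i <= M)%N) ->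
  (forall m n, (W (m + n) <= W m * W n)%N) ->
  (forall n, (n < m0)%N -> l ^+ n <= (W n)%:R) ->
  forall n, l' ^+ n <= (W n)%:R.
Proof.
move=> /andP[l'1 l'l].
(* [r] lies between [b] and 1, so that the interval rescaled by 1 / r stays inside the unit disc. *)
pose a := l^-1; pose b := l'^-1; pose r := (b + 1) / 2.
have l'0 : 0 < l' by lra.
have l0 : 0 < l by lra.
have a0 : 0 < a by rewrite invr_gt0.
have ab : a < b by rewrite ltf_pV2.
have b1 : b < 1 by rewrite invf_lt1.
have r0 : 0 < r by rewrite /r; lra.
have r1 : r < 1 by rewrite /r; lra.
have br : b < r by rewrite /r; lra.
have br1 : 0 < b / r < 1.
  by rewrite divr_gt0 ?(lt_trans a0 ab)//= ltr_pdivrMr// mul1r.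
have rr1 : 0 < 1 - r ^+ 2 by rewrite subr_gt0 expr2; nra.
(* An l^2 bound for coefficients of size at most (M + 4) r^i. *)
pose B := (M%:R + 4) / (1 - r ^+ 2).
have B0 : 0 < B by rewrite divr_gt0// ltr_wpDl.
(* With [m1] points the term b^size * B of [coef0_le_at_points] is below 1/2; [m0] is then chosen to
   make [C * e] below 1/2 too, against |D(0)| >= 1. *)
have [m1 m1P] : exists m1, (b / r) ^+ m1 < (2 * B)^-1.
  by apply: exists_exp_lt => //; rewrite invr_gt0 mulr_gt0.
have [|zs [szs uzs zsP]] := @exists_points m1 (a / r) (b / r).
  by rewrite divr_ge0 ?ltW//= ltr_pM2r ?invr_gt0.
have [||C C0 HC] := @coef0_le_at_points R (b / r) zs _ uzs.
- by case/andP: br1 => /ltW.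
- by move=> z /zsP/andP[az ->]; rewrite (le_trans _ az)// divr_ge0 ?ltW.
pose m0 := (Num.bound (C * (3 / (1 - b)) * 2)).+1.
exists m0 => k d W c c0 ci0 cW c_rec ck dM Wsub Wl n.
rewrite leNgt; apply/negP => Wn.
have [mu [C' [mu0 mul' C'0 Wmu]]] := submul_growth Wsub l'0 Wn.
have cvgW t : 0 < t -> t <= b -> cvgn (series (fun n => (W n)%:R * t ^+ n)).
  move=> t0 tb.
  apply: (@series_le_cvg R _ (geometric C' (mu * t))) => [j|j|j|].
  - by rewrite mulr_ge0// exprn_ge0// ltW.
  - by rewrite /geometric/= mulr_ge0// exprn_ge0// mulr_ge0// ltW.
  - by rewrite /geometric/= exprMn mulrA ler_wpM2r// exprn_ge0// ltW.
  apply: is_cvg_geometric_series; rewrite ger0_norm ?mulr_ge0 ?ltW//.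
  apply: le_lt_trans (_ : mu * b < 1); first by rewrite ler_wpM2l// ltW.
  by rewrite /b ltr_pdivrMr// mul1r.
pose D := kneading_poly R M k d.
have Dt t : a <= t <= b -> `|D.[t]| <= 3 / (1 - b) / m0%:R.
  move=> /andP[at_ tb]; have t0 : 0 < t by exact: lt_le_trans at_.
  have t1 : 0 < t < 1 by rewrite t0 (le_lt_trans tb).
  have := kneading_bound c0 ci0 cW c_rec ck t1 (cvgW t t0 tb).
  set F := limn _ => DF.
  (* For t >= 1 / l each of the first [m0] terms is at least (l t)^n >= 1. *)
  have Fm : m0%:R <= F.
    apply: le_trans (_ : series (fun n => (W n)%:R * t ^+ n) m0 <= _); last first.
      apply: nondecreasing_cvgn_le; last exact: cvgW.
      by apply: nondecreasing_series => j _ _; rewrite mulr_ge0// exprn_ge0// ltW.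
    rewrite /series/= big_mkord.
    rewrite -[X in X%:R <= _](card_ord m0) -sum1_card natr_sum.
    apply: ler_sum => j _; apply: le_trans (_ : l ^+ j * t ^+ j <= _).
      rewrite -exprMn exprn_ege1// -(divff (lt0r_neq0 l0)).
      by rewrite ler_wpM2l// ltW.
    by rewrite ler_wpM2r ?exprn_ge0 ?(ltW t0)// Wl.
  rewrite ler_pdivlMr ?ltr0n//.
  apply: le_trans (_ : `|D.[t]| * F <= _); first by rewrite ler_wpM2l.
  apply: le_trans DF _; rewrite ler_wpM2l// lef_pV2 ?posrE; lra.
have [g [gD gt]] := poly_rescale D r.
have g0 : 1 <= `|g`_0| by rewrite gD expr0 mulr1; exact: kneading_poly0.
have gB : l2le g B.
  move=> N; apply: le_trans (_ : (M%:R + 4) ^+ 2 * \sum_(i < N) (r ^+ 2) ^+ i <= _).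
    rewrite mulr_sumr; apply: ler_sum => i _; rewrite gD exprMn -!exprM mulnC.
    rewrite ler_wpM2r ?exprn_ge0 ?(ltW r0)// -[leLHS]real_normK ?num_real//.
    by rewrite ler_sqr ?nnegrE ?addr_ge0//; exact: kneading_poly_coef.
  have -> : B ^+ 2 = (M%:R + 4) ^+ 2 * ((1 - r ^+ 2) ^- 2) by rewrite /B exprMn exprVn.
  apply: ler_wpM2l; first exact: sqr_ge0.
  apply: le_trans (@sum_geometric_le R (r ^+ 2) N _ _) _; [exact: sqr_ge0|lra|].
  rewrite -exprVn expr2 ler_peMl ?invr_ge0 ?(ltW rr1)//.
  by rewrite invf_ge1//; have := sqr_ge0 r; lra.
have e0 : 0 <= 3 / (1 - b) / m0%:R by rewrite !divr_ge0//; lra.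
have gz : {in zs, forall z, `|g.[z]| <= 3 / (1 - b) / m0%:R}.
  move=> z /zsP; rewrite ler_pdivrMr// ler_pdivlMr// mulrC => zab.
  by rewrite gt; apply: Dt.
have := HC g B _ (ltW B0) e0 gB gz.
have m0P : C * (3 / (1 - b)) * 2 < m0%:R.
  apply: lt_le_trans (archi_boundP _) _; last by rewrite ler_nat.
  by rewrite !mulr_ge0 ?invr_ge0//; lra.
have h1 : (b / r) ^+ size zs * B < 1 / 2.
  rewrite szs -ltr_pdivlMr//; apply: lt_le_trans m1P _.
  by rewrite invfM mul1r.
have h2 : C * (3 / (1 - b) / m0%:R) < 1 / 2.
  by rewrite mulrA ltr_pdivrMr ?ltr0n//; lra.
lra.
Qed.

End GrowthPersistence.

(** * Admissible words *)

Section KoenigCount.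
Variables (R : realType) (M : nat).
Local Notation T := 'I_M.+1.
Implicit Types (u v w : seq T) (x y z : nat -> T) (l : R).

Definition lang_seq (L : pred (seq T)) x := forall n, L (pre n x).

Definition extendable (L : pred (seq T)) : pred (seq T) :=
  fun w => `[< exists2 x, lang_seq L x & pre (size w) x = w >].

(** By König, the non-extendable words of length [N] all die within [K] more digits. So for m >= K
    every word of length N + m begins with an extendable one; iterating gives l^(N k + K) <= E^k *
    const, hence l^N <= E. *)
Lemma growth_extendable (L : pred (seq T)) l : 0 < l ->
  (forall u v, L (u ++ v) -> L u && L v) ->
  (forall n, l ^+ n <= (nwords n L)%:R) ->
  forall n, l ^+ n <= (nwords n (extendable L))%:R.
Proof.
move=> l0 Lcat hl N.
have dead w : ~~ extendable L w -> exists n, forall v, size v = n -> ~~ L (w ++ v).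
  move=> /asboolPn nw; apply: contrapT => nn; apply: nw.
  have [|x xw Lx] := @koenig M L w Lcat; last by exists x.
  move=> n; apply: contrapT => h; apply: nn; exists n => v sv.
  by apply/negP => Lv; apply: h; exists v.
(* For extendable words the length 0 is a dummy value, as the implication is vacuous. *)
have {dead} dead w : exists n, ~~ extendable L w -> forall v, size v = n -> ~~ L (w ++ v).
  by have [/dead[n hn]|/negPn h] := boolP (~~ extendable L w); [exists n|exists 0%N].
pose f w := projT1 (cid (dead w)).
have fP w : ~~ extendable L w -> forall v, size v = f w -> ~~ L (w ++ v).
  exact: (projT2 (cid (dead w))).
pose K := (\max_(w : N.-tuple T) f w)%N.
have step m : (K <= m)%N -> (nwords (N + m) L <= nwords N (extendable L) * nwords m L)%N.
  move=> Km; rewrite /nwords wsum_cat mulnC -wsumMl; apply: leq_wsum => u su.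
  rewrite mulnC -wsumMl; apply: leq_wsum => v sv.
  have [Luv|//] := boolP (L (u ++ v)); have /andP[_ ->] := Lcat _ _ Luv.
  have [//|/fP/(_ (take (f u) v))] := boolP (extendable L u).
  have fK : (f u <= K)%N.
    exact: (@leq_bigmax _ (fun w : N.-tuple T => f w) (Tuple (introT eqP su))).
  rewrite size_takel => [/(_ erefl)|]; last by rewrite sv (leq_trans fK).
  move: Luv; rewrite -{1}(cat_take_drop (f u) v) catA => /Lcat/andP[-> _].
  by [].
set E := nwords N (extendable L) in step *.
have iter k : (nwords (N * k + K) L <= E ^ k * nwords K L)%N.
  elim: k => [|k IH]; first by rewrite muln0 mul1n.
  rewrite mulnS -addnA; apply: leq_trans (step _ (leq_addl _ _)) _.
  by rewrite expnS -mulnA leq_mul2l IH orbT.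
have [E0|E0] := posnP E.
  have := iter 1%N; rewrite E0 exp0n// mul0n leqn0 => /eqP h.
  by have := hl (N * 1 + K)%N; rewrite h leNgt exprn_gt0.
have E0' : 0 < E%:R :> R by rewrite ltr0n.
rewrite -[leRHS]mul1r -ler_pdivrMr//.
apply: (@geometric_bounded _ _ ((nwords K L)%:R / l ^+ K)) => k.
rewrite ler_pdivlMr ?exprn_gt0// expr_div_n mulrAC ler_pdivrMr ?exprn_gt0//.
rewrite -exprM -exprD; apply: le_trans (hl _) _.
by rewrite -natrX -natrM ler_nat [leqRHS]mulnC; exact: iter.
Qed.

(** Each digit of [a] is the largest one that keeps the prefix extendable. *)
Lemma lexle_max_exists (L : pred (seq T)) x0 : lang_seq L x0 ->
  exists2 a, lang_seq L a & forall x n, lang_seq L x -> lexle (pre n x) a.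
Proof.
move=> Lx0.
pose Q w := extendable L w.
have [|w Qw|a aP] := @build_seq M Q (fun w d => forall d', Q (rcons w d') -> (d' <= d)%N).
- by apply/asboolP; exists x0.
- have /asboolP[x Lx xw] := Qw.
  have Qx : Q (rcons w (x (size w))).
    by apply/asboolP; exists x; rewrite // size_rcons preSr xw.
  case: (arg_maxnP (@nat_of_ord M.+1) (P := fun d => Q (rcons w d)) Qx) => d Qd dmax.
  by exists d.
exists a => [n|x n Lx].
  by have [/asboolP[x Lx]] := aP n; rewrite size_pre => <-.
apply: contrapT => /negP/lexle_diff[i [_ e lt]].
have [_ /(_ (x i))] := aP i; rewrite leqNgt lt => /(_ _)/negP; apply => //.
by rewrite -e -preSr; apply/asboolP; exists x; rewrite ?size_pre.
Qed.

End KoenigCount.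

(** * Values of finite words and growth just below a base *)

Section Admissible.
Variables (R : realType) (M : nat).
Local Notation T := 'I_M.+1.
Local Notation cj := (map (@rev_ord M.+1)).
Implicit Types (u v w : seq T) (x y z : nat -> T) (p q l : R).

Fixpoint qval q w : R := if w is d :: w' then (d%:R + qval q w') / q else 0.

Lemma qval_ge0 q w : 0 < q -> 0 <= qval q w.
Proof. by move=> q0; elim: w => //= d w IH; rewrite divr_ge0 ?addr_ge0// ltW. Qed.

Lemma qval_cat q u v : qval q (u ++ v) = qval q u + qval q v / q ^+ size u.
Proof.
elim: u => [|d u IH] /=; first by rewrite expr0 divr1 add0r.
by rewrite IH exprSr invfM addrA mulrDl mulrA.
Qed.

Lemma qval_le_cat q u v : 0 < q -> qval q u <= qval q (u ++ v).
Proof. by move=> q0; rewrite qval_cat lerDl divr_ge0 ?qval_ge0// exprn_ge0// ltW. Qed.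

Definition in_unit q w := (qval q w <= 1) && (qval q (cj w) <= 1).
Definition adm q := on_suffixes (in_unit q).

Lemma adm_cat q u v : 0 < q -> adm q (u ++ v) -> adm q u && adm q v.
Proof.
move=> q0; apply: on_suffixes_cat => {}u {}v; rewrite /in_unit map_cat => /andP[h1 h2].
by rewrite (le_trans (qval_le_cat _ _ q0) h1) (le_trans (qval_le_cat _ _ q0) h2).
Qed.

Lemma adm_cj q w : adm q (cj w) = adm q w.
Proof. by apply: on_suffixes_cj => v; rewrite /in_unit cjK andbC. Qed.

Lemma adm_le1 q w : adm q w -> qval q w <= 1.
Proof. by case: w => [_|d w /andP[/andP[]]//]; rewrite ler01. Qed.

Lemma lang_adm_sh q i x : 0 < q -> lang_seq (adm q) x -> lang_seq (adm q) (sh i x).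
Proof. by move=> q0 Lx n; have := Lx (i + n)%N; rewrite preD => /(adm_cat q0)/andP[]. Qed.

Lemma lang_adm_conjs q x : lang_seq (adm q) x -> lang_seq (adm q) (conjs x).
Proof. by move=> Lx n; rewrite pre_conj adm_cj. Qed.

Lemma qval_cvg q w : q != 0 -> (fun p => qval p w) @ q --> qval q w.
Proof.
move=> q0; elim: w => [|d w IH] /=; first exact: cvg_cst.
apply: cvgM; first by apply: cvgD => //; exact: cvg_cst.
by apply: cvgV => //; exact: cvg_id.
Qed.

(** Values are continuous in the base, so a value above 1 at [q] stays above 1 nearby. *)
Lemma adm_near q w : 0 < q -> \forall p \near q, adm p w -> adm q w.
Proof.
move=> q0; have q0' : q != 0 by rewrite gt_eqF.
have qval_near v : \forall p \near q, qval p v <= 1 -> qval q v <= 1.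
  have [v1|v1] := leP (qval q v) 1; first by near=> p.
  have : \forall p \near q, 1 < qval p v by exact: (@cvgr_gt _ _ _ _ _ _ (@qval_cvg q v q0') _ v1).
  by apply: filterS => p h; rewrite leNgt h.
elim: w => [|d w IH]; first by near=> p.
near=> p => /andP[/andP[h2 h3] h1]; apply/andP; split; last first.
  by move: h1; near: p.
apply/andP; split.
  by move: h2; near: p; exact: (qval_near (d :: w)).
by move: h3; near: p; exact: (qval_near (cj (d :: w))).
Unshelve. all: by end_near. Qed.

Lemma wsum_near (F : set_system R) (fF : Filter F) n (f : R -> seq T -> nat) g :
  (forall w, \forall p \near F, (f p w <= g w)%N) ->
  \forall p \near F, (wsum n (f p) <= wsum n g)%N.
Proof.
elim: n f g => [|n IH] f g fg /=; first exact: fg.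
have {}IH d := IH (fun p w => f p (d :: w)) (fun w => g (d :: w)) (fun w => fg (d :: w)).
elim: (index_enum T) => [|d s IHs].
  by near=> p; rewrite !big_nil.
near=> p; rewrite !big_cons leq_add//; first by near: p; exact: IH.
by near: p; exact: IHs.
Unshelve. all: by end_near. Qed.

Lemma nwords_adm_near q n : 0 < q ->
  \forall p \near q, (nwords n (adm p) <= nwords n (adm q))%N.
Proof.
move=> q0.
apply: (@wsum_near (nbhs q) _ n (fun p w => adm p w) (fun w => adm q w)) => w; near=> p.
have : adm p w -> adm q w by near: p; exact: adm_near.
by case: (adm p w) => // ->.
Unshelve. all: by end_near. Qed.

Lemma nwords_adm_submul q m n : 0 < q ->
  (nwords (m + n) (adm q) <= nwords m (adm q) * nwords n (adm q))%N.
Proof. by move=> q0; apply: nwords_submul => u v; exact: adm_cat. Qed.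

(** At the first difference [y] gains a whole digit, which outweighs the remaining suffix of [w],
    worth at most 1. *)
Lemma qval_lexle p w y : 0 < p -> lexle w y -> on_suffixes (fun v => qval p v <= 1) (behead w) ->
  qval p w <= qval p (pre (size w) y).
Proof.
move=> p0; elim: w y => [//|d w IH] y; rewrite [size _]/= preS [lexle _ _]/= [behead _]/=.
move=> h hw; rewrite /= ler_pM2r ?invr_gt0//.
have w1 : qval p w <= 1 by case: w hw {IH h} => [_|e w /andP[]//]; rewrite ler01.
case/orP: h => [dy|/andP[/eqP-> wy]].
  apply: le_trans (_ : d%:R + 1 <= _); first by rewrite lerD2l.
  rewrite natr1; apply: le_trans (_ : (y 0%N)%:R <= _); first by rewrite ler_nat.
  by rewrite lerDl qval_ge0.
rewrite lerD2l; apply: IH => //.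
by case: w hw {w1 wy} => //= e w /andP[].
Qed.

(** Induction from the shortest suffix, applied to [w] and to its reflection, turns the order bounds
    into value bounds. *)
Lemma within_lex_adm p b w : 0 < p -> (forall n, qval p (pre n b) <= 1) ->
  on_suffixes (within_lex b) w -> adm p w.
Proof.
move=> p0 vb.
have vle v : on_suffixes (within_lex b) v -> on_suffixes (fun v => qval p v <= 1) v.
  elim: v => [//|d v IH] /= /andP[/andP[h _] /IH hv]; rewrite hv andbT.
  exact: le_trans (qval_lexle p0 h hv) (vb _).
move=> hw; have hcw : on_suffixes (within_lex b) (cj w).
  by rewrite on_suffixes_cj// => v; exact: within_lex_cj.
move: (vle _ hw) (vle _ hcw) => {hw hcw}.
elim: w => //= d w IH /andP[h1 h2] /andP[h3 h4].
by rewrite /adm/= /in_unit h1 h3/=; exact: IH.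
Qed.

Lemma on_suffixes_pre (P : pred (seq T)) x n :
  (forall i j, (i + j <= n)%N -> P (pre j (sh i x))) -> on_suffixes P (pre n x).
Proof.
elim: n x => [//|n IH] x h; rewrite preS /= -preS (h 0%N n.+1)//=.
by apply: IH => i j ij; rewrite sh_sh; apply: h; rewrite -addnA.
Qed.

Lemma lexle_eq_pre w y z : pre (size w) y = pre (size w) z -> lexle w y -> lexle w z.
Proof. by move=> e h; apply: lexle_trans h _; rewrite e; exact: lexle_pre_refl. Qed.

Lemma qval_lower_seq p (a : nat -> T) m n : 0 < p ->
  qval p (pre n (lower_seq a m)) <= qval p (pre m.+1 (lower_seq a m)).
Proof.
move=> p0; set b := lower_seq a m; have [nm|mn] := leqP n m.+1.
  by rewrite -(subnKC nm) preD; exact: qval_le_cat.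
rewrite -(subnKC (ltnW mn)) preD qval_cat (_ : qval p (pre (n - _) _) = 0).
  by rewrite mul0r addr0.
have : forall j, sh m.+1 b j = ord0 by move=> j; rewrite /sh /b lower_seq_gt// leq_addr.
elim: (n - m.+1)%N (sh m.+1 b) => [//|N IH] y y0.
by rewrite preS /= y0 IH ?addr0 ?mul0r// => j; rewrite /sh y0.
Qed.

Lemma qval_lower_seq_lt q (a : nat -> T) m : 0 < q -> (0 < a m)%N ->
  qval q (pre m.+1 (lower_seq a m)) < qval q (pre m.+1 a).
Proof.
move=> q0 am; rewrite !preSr -!cats1 !qval_cat !size_pre.
rewrite (_ : pre m (lower_seq a m) = pre m a); last first.
  by apply/eq_pre => j jm; rewrite lower_seq_lt.
rewrite ltrD2l ltr_pM2r ?invr_gt0 ?exprn_gt0//= !addr0 ltr_pM2r ?invr_gt0//.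
by rewrite lower_seq_at// ltr_nat prednK.
Qed.

(** This is the left lower semicontinuity: almost all of the growth at [q] is already present in
    some smaller base. *)
Lemma adm_growth_below q l l' : (0 < M)%N -> 1 < q -> 1 < l' < l ->
  (forall n, l ^+ n <= (nwords n (adm q))%:R) ->
  exists2 p, 1 < p < q & forall n, l' ^+ n <= (nwords n (adm p))%:R.
Proof.
move=> M0 q1 ll lq; have /andP[l'1 l'l] := ll.
have q0 : 0 < q by lra.
have l0 : 0 < l by lra.
have adm_c u v := @adm_cat q u v q0.
(* Passing to extendable words loses no growth and lets each of them be compared with the maximal
   sequence [a]. *)
have ext := growth_extendable l0 adm_c lq.
have [x0 Lx0] : exists x, lang_seq (adm q) x.
  have : (0 < nwords 0 (extendable (adm q)))%N.
    by rewrite -(ltr0n R); apply: lt_le_trans (ext 0%N); rewrite expr0.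
  by case/nwords_ex => w _ /asboolP[x Lx _]; exists x.
have [a La amax] := lexle_max_exists Lx0.
have a_sh i n : lexle (pre n (sh i a)) a by apply: amax; exact: lang_adm_sh.
have [m0 persist] := growth_persist M ll.
(* Otherwise [a] ends in zeros from [m0] on; the reflected tail is constantly [M] and at most [a],
   so the digit of [a] at [m0] would be [M]. *)
have [m [m0m am]] : exists m, (m0 <= m)%N /\ (0 < a m)%N.
  apply: contrapT => h.
  have a0 j : sh m0 a j = ord0.
    apply: val_inj; apply/eqP; rewrite /= eqn0Ngt; apply/negP => aj.
    by apply: h; exists (m0 + j)%N; rewrite leq_addr.
  have cE : conjs (sh m0 a) = fun=> ord_max.
    by apply/funext => j; rewrite /conjs a0; apply: val_inj => /=; lia.
  have := amax (conjs (sh m0 a)) m0.+1 (lang_adm_conjs (lang_adm_sh m0 q0 La)).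
  rewrite cE => /lexle_ord_max/(_ (ltnSn _)) am; apply: h; exists m0.
  by rewrite am.
pose b := lower_seq a m.
have vb : qval q (pre m.+1 b) < 1.
  by apply: lt_le_trans (qval_lower_seq_lt q0 am) _; exact: adm_le1.
(* Lowering a digit of [a] made the value of [b] strictly less than 1, which leaves room to lower
   the base. *)
have [p pq vp] : exists2 p, 1 < p < q & qval p (pre m.+1 b) < 1.
  have : \forall p \near q, qval p (pre m.+1 b) < 1.
    by apply: (@cvgr_lt _ _ _ _ _ _ (@qval_cvg q _ _) _ vb); rewrite gt_eqF.
  case/nbhs_ballP => e /= e0 he.
  pose p := Num.max ((1 + q) / 2) (q - e / 2).
  have p1 : (1 + q) / 2 <= p by rewrite /p le_max lexx.
  have p2 : q - e / 2 <= p by rewrite /p le_max lexx orbT.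
  have p3 : p < q by rewrite /p gt_max; apply/andP; split; lra.
  exists p; first by apply/andP; split; lra.
  by apply: he; rewrite /ball/= ger0_norm; lra.
exists p => //.
have p0 : 0 < p by lra.
have vbp n : qval p (pre n b) <= 1.
  by apply: le_trans (qval_lower_seq a m n p0) _; exact: ltW.
have [k [_ rec ck]] := nC_lower_seq M0 am a_sh.
move=> n; apply: le_trans (_ : (nW b n)%:R <= _); last first.
  by rewrite ler_nat; apply: leq_nwords => w _; exact: within_lex_adm.
apply: (persist k (fun i => b i) (nW b) (fun i n => nC b n (sh i b))) => //.
- by move=> j; rewrite sh0 nC_b.
- by move=> i j; exact: nC_le.
- by move=> i; rewrite -ltnS ltn_ord.
- by move=> i j; exact: nW_submul.
(* Words shorter than [m0] only see digits where [a] and [b] agree, so being below [a] is being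
   below [b]. *)
move=> j jm; apply: le_trans (ext j) _; rewrite ler_nat; apply: leq_nwords => w sw.
move=> /asboolP[x Lx <-]; rewrite sw.
have lb y i : (i <= m)%N -> lang_seq (adm q) y -> lexle (pre i y) b.
  move=> im Ly; apply: lexle_eq_pre (amax y i Ly); rewrite size_pre.
  by apply/eq_pre => s si; rewrite /b lower_seq_lt//; lia.
apply: on_suffixes_pre => s i si; rewrite /within_lex -pre_conj !lb//; try lia.
- by apply: lang_adm_conjs; exact: lang_adm_sh.
- exact: lang_adm_sh.
Qed.

End Admissible.

(** * Unique expansions *)

Section Expansions.
Variables (R : realType) (M : nat).
Local Notation T := 'I_M.+1.
Local Notation cj := (map (@rev_ord M.+1)).
Implicit Types (u v w : seq T) (x y z : Omega M) (p q t l : R).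

Lemma partial_pi q x n :
  series (fun j : nat => (x j)%:R / q ^+ j.+1) n = qval q (pre n x).
Proof.
elim: n => [|n IH]; first by rewrite /series/= big_geq.
rewrite seriesSr IH preSr -cats1 qval_cat size_pre /= addr0 exprSr invfM.
by rewrite mulrA mulrAC.
Qed.

Lemma qval_ub q w : 1 < q -> qval q w <= M%:R / (q - 1).
Proof.
move=> q1; have q10 : 0 < q - 1 by lra.
elim: w => [|d w IH] /=; first by rewrite divr_ge0// ltW.
rewrite ler_pdivrMr; last lra.
have dM : d%:R <= M%:R :> R by rewrite ler_nat -ltnS ltn_ord.
have -> : M%:R / (q - 1) * q = M%:R + M%:R / (q - 1) by field; rewrite gt_eqF.
exact: lerD.
Qed.

Section Base.
Variable q : R.
Hypothesis q1 : 1 < q.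
Local Notation pi := (@pi_q R M q).
Local Notation K := (M%:R / (q - 1)).

Let q0 : 0 < q. Proof. exact: lt_trans ltr01 q1. Qed.

Lemma pi_cvg x : (fun n => qval q (pre n x)) @ \oo --> pi x.
Proof.
rewrite /pi_q (_ : series _ = fun n => qval q (pre n x)); last first.
  by apply/funext => n; exact: partial_pi.
apply: nondecreasing_is_cvgn.
  by apply/nondecreasing_seqP => n; rewrite preSr -cats1; exact: qval_le_cat q0.
by exists K => _ [n _ <-]; exact: qval_ub.
Qed.

Lemma pi_le x c : (forall n, qval q (pre n x) <= c) -> pi x <= c.
Proof.
move=> h; rewrite -(cvg_lim _ (@pi_cvg x))//; apply: limr_le; last by near=> n.
by apply/cvg_ex; exists (pi x); exact: pi_cvg.
Unshelve. all: by end_near. Qed.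

Lemma qval_le_pi x n : qval q (pre n x) <= pi x.
Proof.
rewrite -(cvg_lim _ (@pi_cvg x))//; apply: limr_ge.
  by apply/cvg_ex; exists (pi x); exact: pi_cvg.
near=> m; have nm : (n <= m)%N by near: m; exact: nbhs_infty_ge.
by rewrite -(subnKC nm) preD qval_le_cat.
Unshelve. all: by end_near. Qed.

Lemma pi_ge0 x : 0 <= pi x. Proof. exact: (qval_le_pi x 0). Qed.

Lemma pi_ub x : pi x <= K. Proof. by apply: pi_le => n; exact: qval_ub. Qed.

Lemma pi_cons x : pi x = ((x 0%N)%:R + pi (sh 1 x)) / q.
Proof.
have h1 : (fun n => qval q (pre n.+1 x)) @ \oo --> pi x.
  by rewrite (cvg_shiftS (fun n => qval q (pre n x))); exact: pi_cvg.
have h2 : (fun n => qval q (pre n.+1 x)) @ \oo --> ((x 0%N)%:R + pi (sh 1 x)) / q.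
  under eq_fun do rewrite preS/=.
  by apply: cvgMl; apply: cvgD; [exact: cvg_cst|exact: pi_cvg].
exact: (cvg_unique _ h1 h2).
Qed.

Lemma pi_split n x : pi x = qval q (pre n x) + pi (sh n x) / q ^+ n.
Proof.
elim: n x => [|n IH] x; first by rewrite sh0 expr0 divr1 add0r.
rewrite pi_cons IH preS /= sh_sh exprSr invfM addrA mulrDl mulrA.
by [].
Qed.

(** Digitwise, [x] and its reflection add up to the constant sequence [M], of value M / (q - 1). *)
Lemma pi_conjs x : pi (conjs x) = K - pi x.
Proof.
pose xM : Omega M := fun=> ord_max.
have xME : pi xM = K.
  have := pi_cons xM; rewrite (_ : sh 1 xM = xM)// /= => h.
  have q10 : q - 1 != 0 by rewrite gt_eqF// subr_gt0.
  apply: (mulIf q10); rewrite divfK// mulrBr mulr1 {1}h divfK ?gt_eqF//.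
  by rewrite addrK.
have vE w : qval q (cj w) + qval q w = qval q (map (fun=> ord_max) w : seq T).
  elim: w => [|d w IH] /=; first by rewrite addr0.
  rewrite -IH -mulrDl; congr (_ / _).
  rewrite subSS natrB; last by rewrite -ltnS ltn_ord.
  ring.
have h1 : (fun n => qval q (pre n (conjs x)) + qval q (pre n x)) @ \oo --> pi (conjs x) + pi x.
  by apply: cvgD; exact: pi_cvg.
have h2 : (fun n => qval q (pre n (conjs x)) + qval q (pre n x)) @ \oo --> pi xM.
  rewrite (_ : (fun n => _) = fun n => qval q (pre n xM)); first exact: pi_cvg.
  by apply/funext => n; rewrite pre_conj vE /pre /mkseq -map_comp.
have := cvg_unique _ h1 h2; rewrite xME => /(_ (@norm_hausdorff _ _)) <-.
by rewrite addrK.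
Qed.

Definition unique_expansion x := forall z, pi z = pi x -> z = x.

Lemma symbolic_univoqueP x : symbolic_univoque M q x <-> unique_expansion x.
Proof.
split=> [[_ [y [_ yu]]] z zx|u].
  by rewrite -(yu _ zx) -(yu x).
split; first by rewrite /I_q /= in_itv/= pi_ge0 pi_ub.
by exists x; split => // z zx; rewrite -(u z).
Qed.

Lemma unique_expansion_conjs x : unique_expansion x -> unique_expansion (conjs x).
Proof.
move=> u z; rewrite pi_conjs => zx; rewrite -(conjsK z); congr conjs.
by apply: u; rewrite pi_conjs zx; ring.
Qed.

(** If the next digits differed, the tail of [z] would differ from that of [x] by at least 1 and
    leave [0, M / (q - 1)]. *)
Lemma unique_expansion_of_lt1 x :
  (forall n, pi (sh n x) < 1) -> (forall n, pi (conjs (sh n x)) < 1) ->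
  unique_expansion x.
Proof.
move=> h1 h2 z zx; apply: pre_inj => n.
suff : pre n z = pre n x /\ pi (sh n z) = pi (sh n x) by case.
elim: n => [|n [IH e]]; first by rewrite !sh0.
have := e; rewrite pi_cons (pi_cons (sh n x)) !sh_sh addn1 => /mulIf.
rewrite invr_eq0 gt_eqF// => /(_ isT) E.
have E0 : sh n z 0%N = sh n x 0%N.
  have {h1} := h1 n.+1; have {h2} := h2 n.+1; rewrite pi_conjs => h2 h1.
  have z0 := pi_ge0 (sh n.+1 z); have zK := pi_ub (sh n.+1 z).
  apply: val_inj => /=; case: (ltngtP (sh n z 0%N) (sh n x 0%N)) => //.
  - by rewrite -(ler_nat R) -natr1 => lt; exfalso; lra.
  - by rewrite -(ler_nat R) -natr1 => lt; exfalso; lra.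
split; last by move: E; rewrite E0 => /addrI.
by rewrite !preSr IH; move: E0; rewrite /sh addn0 => ->.
Qed.

(** * Necessary conditions for unique expansions when q <= M + 1 *)

Section SmallBase.
Hypothesis qM : q <= M.+1%:R.

Let K_ge1 : 1 <= K.
Proof. rewrite ler_pdivlMr ?subr_gt0// mul1r; move: qM; rewrite -natr1; lra. Qed.

Let greedy_digit t : 0 <= t <= K -> exists d : T, 0 <= q * t - d%:R <= K.
Proof.
move=> /andP[t0 tK].
have P0 : (ord0 : T)%:R <= q * t by rewrite mulr_ge0// ltW.
case: (arg_maxnP (@nat_of_ord M.+1) (P := fun d : T => d%:R <= q * t) P0) => d dt dmax.
exists d; rewrite subr_ge0 dt/= lerBlDr.
have [dM|dM] := ltnP d M; last first.
  have -> : nat_of_ord d = M by apply/eqP; rewrite eqn_leq dM -ltnS ltn_ord.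
  have -> : K + M%:R = q * K by field; rewrite gt_eqF// subr_gt0.
  by rewrite ler_pM2l.
have : ~~ ((inord d.+1 : T)%:R <= q * t).
  by apply/negP => /dmax; rewrite /= inordK ?ltnS// ltnn.
rewrite inordK ?ltnS// -ltNge -natr1 => lt.
by apply: ltW; apply: lt_le_trans lt _; rewrite addrC lerD2r.
Qed.

(** Greedy digits keep the remainder, rescaled by q^n, in [0, M / (q - 1)]. *)
Lemma expansion_exists t : 0 <= t <= K -> exists x, pi x = t.
Proof.
move=> tK.
have [||x xP] := @build_seq M (fun w => 0 <= (t - qval q w) * q ^+ size w <= K) (fun _ _ => True).
- by rewrite /= subr0 expr0 mulr1.
- move=> w /greedy_digit[d dK]; exists d => //; rewrite size_rcons -cats1 qval_cat /= addr0.
  rewrite (_ : _ * _ = q * ((t - qval q w) * q ^+ size w) - d%:R)//.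
  by rewrite exprS; field; rewrite expf_neq0 gt_eqF.
have {}xP n : 0 <= (t - qval q (pre n x)) * q ^+ n <= K.
  by have [] := xP n; rewrite size_pre.
exists x; apply/eqP; rewrite eq_le; apply/andP; split.
  apply: pi_le => n; have /andP[+ _] := xP n.
  by rewrite pmulr_lge0 ?exprn_gt0// subr_ge0.
rewrite leNgt; apply/negP => lt.
have K0 : 0 < K by exact: lt_le_trans K_ge1.
have [||n] := @exists_exp_lt R q^-1 ((t - pi x) / K).
- by rewrite invr_gt0 q0 invf_lt1.
- by rewrite divr_gt0// subr_gt0.
rewrite ltr_pdivlMr// exprVn mulrC ltr_pdivrMr ?exprn_gt0// => lt2.
have /andP[_] := xP n; rewrite leNgt => /negP; apply.
apply: lt_le_trans lt2 _; rewrite ler_wpM2r ?exprn_ge0 ?(ltW q0)//.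
by rewrite lerD2l lerN2; exact: qval_le_pi.
Qed.

(** The classical criterion for unique expansions, stated with values of tails in place of a
    quasi-greedy expansion of 1. *)
Definition tail_lt1 x := forall n,
  ((x n < M)%N -> pi (sh n.+1 x) < 1) /\ ((0 < x n)%N -> pi (conjs (sh n.+1 x)) < 1).

(** If the tail were worth at least 1, raising digit [n] by one and expanding the tail value minus 1
    would give a second expansion. *)
Let unique_tail_lt1_half x n : unique_expansion x -> (x n < M)%N -> pi (sh n.+1 x) < 1.
Proof.
move=> u xn; rewrite ltNge; apply/negP => ge1.
have [|y yE] := @expansion_exists (pi (sh n.+1 x) - 1).
  have := pi_ub (sh n.+1 x); move=> *; apply/andP; split; lra.
pose z : Omega M := fun j => if (j < n)%N then x j else
  if j == n then inord (x n).+1 else y (j - n.+1)%N.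
have zn : z n = (x n).+1 :> nat by rewrite /z ltnn eqxx inordK.
suff : z = x by move=> /(congr1 (fun f : Omega M => nat_of_ord (f n))); rewrite zn; lia.
apply: u; rewrite (pi_split n.+1 z) (pi_split n.+1 x).
have -> : sh n.+1 z = y.
  apply/funext => j; rewrite /sh /z ltnNge ltnW ?leq_addr//= gtn_eqF ?leq_addr//.
  by rewrite addKn.
have zx : pre n z = pre n x by apply/eq_pre => j jn; rewrite /z jn.
rewrite yE !preSr zx -!cats1 !qval_cat size_pre /= zn -natr1 !addr0 exprS.
by field; rewrite expf_neq0 gt_eqF.
Qed.

Lemma unique_tail_lt1 x : unique_expansion x -> tail_lt1 x.
Proof.
move=> u n; split; first exact: unique_tail_lt1_half.
move=> xn; apply: (@unique_tail_lt1_half (conjs x) n).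
  exact: unique_expansion_conjs.
by rewrite /conjs /=; have := ltn_ord (x n); lia.
Qed.

Lemma tail_lt1_sh m x : tail_lt1 x -> tail_lt1 (sh m x).
Proof. by move=> h n; rewrite sh_sh addnS; exact: h. Qed.

Lemma tail_lt1_conjs x : tail_lt1 x -> tail_lt1 (conjs x).
Proof.
move=> h n; have [h1 h2] := h n; split => xn.
  by apply: h2; move: xn; rewrite /conjs /=; have := ltn_ord (x n); lia.
have -> : conjs (sh n.+1 (conjs x)) = sh n.+1 x by rewrite -[RHS]conjsK.
by apply: h1; move: xn; rewrite /conjs /=; have := ltn_ord (x n); lia.
Qed.

(** After a digit [M] in a tail of value below 1, the next tail is worth less than q - M <= 1. *)
Lemma tail_lt1_pi x n : tail_lt1 x -> pi x < 1 -> pi (sh n x) < 1.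
Proof.
move=> h x1; elim: n => [|n IH]; first by rewrite sh0.
have [xM|Mx] := ltnP (x n) M; first by have [/(_ xM)] := h n.
move: IH; rewrite pi_cons sh_sh addn1 /sh addn0 ltr_pdivrMr// mul1r.
have : M%:R <= (x n)%:R :> R by rewrite ler_nat.
move: qM; rewrite -natr1; lra.
Qed.

(** A run of [e], then one arbitrary digit, then an admissible word; or a run of [e] alone. Up to a
    sum over shorter lengths there are no more of these than admissible words. *)
Fixpoint almost_adm (e : T) w := if w is d :: w' then
  adm q w' || (d == e) && almost_adm e w' else true.

Lemma almost_adm_cj e w : almost_adm e (cj w) = almost_adm (rev_ord e) w.
Proof.
elim: w => //= d w ->; rewrite adm_cj; congr (_ || (_ && _)).
by rewrite -(inj_eq rev_ord_inj) rev_ordK.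
Qed.

(** Leading zeros are skipped; after the first nonzero digit both the tail and its reflection are
    worth less than 1, and so are all later ones. *)
Let tail_lt1_almost_adm0 x n : tail_lt1 x -> pi (sh 1 x) < 1 -> almost_adm ord0 (pre n x).
Proof.
elim: n x => [//|n IH] x h x1; rewrite preS /=.
have [x0|x0] := posnP (x 0%N); apply/orP.
  right; rewrite (_ : x 0%N == ord0) ?IH//; last by apply/eqP; apply: val_inj.
    exact: tail_lt1_sh.
  by rewrite -[X in X < 1]/(pi (sh 1 (sh 1 x))); apply: tail_lt1_pi; [exact: tail_lt1_sh|].
left; have [_ /(_ x0) cx1] := h 0%N.
have hs := tail_lt1_sh 1 h.
apply: on_suffixes_pre => i j _; rewrite /in_unit -pre_conj.
rewrite (le_trans (qval_le_pi _ _)) ?(le_trans (qval_le_pi _ _))//.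
  exact: (ltW (tail_lt1_pi i (tail_lt1_conjs hs) cx1)).
exact: (ltW (tail_lt1_pi i hs x1)).
Qed.

Lemma tail_lt1_almost_adm x n : (0 < M)%N -> tail_lt1 x ->
  almost_adm ord0 (pre n x) || almost_adm ord_max (pre n x).
Proof.
move=> M0 h; have [h1 h2] := h 0%N; apply/orP.
have [x0|x0] := ltnP (x 0%N) M; first by left; apply: tail_lt1_almost_adm0 => //; exact: h1.
right; rewrite (_ : ord_max = rev_ord ord0); last by apply: val_inj => /=; lia.
rewrite -almost_adm_cj -pre_conj; apply: tail_lt1_almost_adm0.
  exact: tail_lt1_conjs.
by apply: h2; exact: leq_trans x0.
Qed.

Lemma nwords_almost_adm e n :
  (nwords n (almost_adm e) <= 1 + M.+1 * \sum_(j < n) nwords j (@adm R M q))%N.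
Proof.
elim: n => [//|n IH].
apply: (@leq_trans (M.+1 * nwords n (@adm R M q) + nwords n (almost_adm e))); last first.
  by rewrite big_ord_recr mulnDr addnA [leqLHS]addnC leq_add2r.
rewrite {1}/nwords/= -[X in (X * _ + _)%N](card_ord M.+1) -sum_nat_const.
rewrite -[X in (_ <= _ + X)%N]mul1n.
have <- : (\sum_(d : T) (d == e) = 1)%N.
  by rewrite (bigD1 e)//= eqxx big1// => d /negbTE->.
rewrite big_distrl -big_split/=; apply: leq_sum => d _.
rewrite /nwords -wsumMl -wsumD; apply: leq_wsum => w _.
by case: (adm q w); case: (d == e) => //=; rewrite ?mul1n ?leq_addr.
Qed.

End SmallBase.
End Base.

Lemma qval_base_le p q w : 0 < p < q -> qval q w <= p / q * qval p w.
Proof.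
move=> /andP[p0 pq]; have q0 : 0 < q by lra.
elim: w => [|d w IH] /=; first by rewrite mulr0.
have -> : p / q * ((d%:R + qval p w) / p) = (d%:R + qval p w) / q.
  by field; rewrite !gt_eqF.
rewrite ler_pM2r ?invr_gt0// lerD2l; apply: le_trans IH _.
by rewrite ler_piMl ?qval_ge0// ler_pdivrMr// mul1r ltW.
Qed.

(** Raising the base multiplies values by at most p / q, which makes the bound 1 strict. *)
Lemma lang_adm_univoque p q x : 1 < p < q -> lang_seq (adm p) x ->
  symbolic_univoque M q x.
Proof.
move=> /andP[p1 pq] Lx; have p0 : 0 < p by lra.
have q1 : 1 < q by lra.
have lt1 y : lang_seq (adm p) y -> pi_q q y < 1.
  move=> Ly; apply: (@le_lt_trans _ _ (p / q)); last by rewrite ltr_pdivrMr; lra.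
  apply: pi_le => // n; apply: le_trans (qval_base_le (pre n y) (_ : 0 < p < q)) _.
    by rewrite p0.
  by rewrite ler_piMr ?(adm_le1 (Ly n))// divr_ge0// ltW// (lt_trans p0).
apply/symbolic_univoqueP => //; apply: unique_expansion_of_lt1 => // n; apply: lt1.
  exact: lang_adm_sh.
by apply: lang_adm_conjs; exact: lang_adm_sh.
Qed.

(** * Growth of blocks against growth of admissible words *)

Definition block (X : set (Omega M)) : pred (seq T) :=
  fun w => `[< exists x, X x /\ exists n, w = pre (size w) (sh n x) >].

Lemma card_blocks n X : #|blocks n X| = nwords n (block X).
Proof.
rewrite -card_nwords; apply: eq_card => w; rewrite !inE; apply: asbool_equiv_eq.
split=> -[x [Xx [m h]]]; exists x; split => //; exists m.
  apply: (@eq_from_nth _ ord0); first by rewrite size_pre.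
  rewrite size_tuple => i ni; rewrite nth_mkseq//.
  by have := h (Ordinal ni); rewrite (tnth_nth ord0).
by move=> i; rewrite (tnth_nth ord0) h size_tuple nth_mkseq.
Qed.

Lemma block_cat X u v : block X (u ++ v) -> block X u && block X v.
Proof.
move=> /asboolP[x [Xx [n]]]; rewrite size_cat preD => /eqP.
rewrite eqseq_cat ?size_pre// sh_sh => /andP[/eqP e1 /eqP e2].
apply/andP; split; apply/asboolP; exists x; split=> //.
  by exists n.
by exists (n + size u)%N.
Qed.

Lemma adm_growth_univoque p q l : 1 < p < q -> 0 < l ->
  (forall n, l ^+ n <= (nwords n (@adm R M p))%:R) ->
  forall n, l ^+ n <= (nwords n (block (symbolic_univoque M q)))%:R.
Proof.
move=> pq l0 h n; have p0 : 0 < p by case/andP: pq; lra.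
apply: le_trans (growth_extendable l0 (fun u v => @adm_cat _ _ p u v p0) h n) _.
rewrite ler_nat; apply: leq_nwords => w _ /asboolP[x Lx xw]; apply/asboolP.
by exists x; split; [exact: lang_adm_univoque pq Lx | exists 0%N].
Qed.

(** Blocks of univoque sequences are almost admissible, and the resulting sum over shorter lengths
    does not raise an exponential rate above 1. *)
Lemma univoque_growth_adm q l : (0 < M)%N -> 1 < q <= M.+1%:R -> 1 < l ->
  (forall n, l ^+ n <= (nwords n (block (symbolic_univoque M q)))%:R) ->
  forall n, l ^+ n <= (nwords n (@adm R M q))%:R.
Proof.
move=> M0 /andP[q1 qM] l1 h n; rewrite leNgt; apply/negP => lt.
have q0 : 0 < q by lra.
have V m : (nwords m (block (symbolic_univoque M q)) <=
    2 * (1 + M.+1 * \sum_(j < m) nwords j (@adm R M q)))%N.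
  apply: (@leq_trans (nwords m (almost_adm q ord0) + nwords m (almost_adm q ord_max)))%N.
    rewrite /nwords -wsumD; apply: leq_wsum => w sw.
    have [/asboolP[x [/symbolic_univoqueP-/(_ q1) ux [i ->]]]|//] := boolP (block _ w).
    have := tail_lt1_almost_adm q1 qM (size w) M0 (tail_lt1_sh i (unique_tail_lt1 q1 qM ux)).
    by case: (almost_adm q ord0 _); case: (almost_adm q ord_max _).
  rewrite mul2n -addnn leq_add//; exact: nwords_almost_adm.
have [mu [C [mu0 mul C0 Cmu]]] := submul_growth
  (fun m n => @nwords_adm_submul R M q m n q0) (lt_trans ltr01 l1) lt.
(* A rate strictly between max(mu, 1) and [l]: above 1, so that the geometric sum up to m is
   O(nu^m). *)
pose nu := (Num.max mu 1 + l) / 2.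
have [nu1 [nul munu]] : 1 < nu /\ (nu < l /\ mu <= nu).
  have m1 : mu <= Num.max mu 1 by rewrite le_max lexx.
  have m2 : 1 <= Num.max mu 1 by rewrite le_max lexx orbT.
  have m3 : Num.max mu 1 < l by rewrite gt_max mul l1.
  by rewrite /nu; move: (Num.max mu 1) m1 m2 m3 => x *; split; [|split]; lra.
have S m : \sum_(j < m) (nwords j (@adm R M q))%:R <= C / (nu - 1) * nu ^+ m.
  apply: (@le_trans _ _ (C * \sum_(j < m) nu ^+ j)).
    rewrite mulr_sumr; apply: ler_sum => j _; apply: le_trans (Cmu j) _.
    by rewrite ler_wpM2l//; apply: lerXn2r; rewrite ?nnegrE//; lra.
  rewrite -mulrA ler_wpM2l// mulrC ler_pdivlMr ?subr_gt0//.
  have := subrX1 nu m; lra.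
have : l / nu <= 1.
  apply: (@geometric_bounded _ _ (2 * (1 + M.+1%:R * (C / (nu - 1))))) => m.
  rewrite expr_div_n ler_pdivrMr ?exprn_gt0//; last by lra.
  apply: le_trans (h m) _.
  apply: (@le_trans _ _
    (2 * (1 + M.+1%:R * \sum_(j < m) (nwords j (@adm R M q))%:R))).
    apply: (@le_trans _ _ (2 * (1 + M.+1 * \sum_(j < m) nwords j (@adm R M q)))%N%:R).
      by rewrite ler_nat.
    by rewrite natrM natrD natrM natr_sum.
  rewrite -mulrA ler_pM2l// mulrDl mul1r lerD ?exprn_ege1//; first by lra.
  by rewrite -mulrA ler_wpM2l.
rewrite ler_pdivrMr; lra.
Qed.

(** The zero sequence is the unique expansion of 0. *)
Lemma block_univoque_gt0 q n : 1 < q -> (0 < nwords n (block (symbolic_univoque M q)))%N.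
Proof.
move=> q1; pose x : Omega M := fun=> ord0.
have q0 : 0 < q by lra.
have Ux : symbolic_univoque M q x.
  apply/symbolic_univoqueP => // z.
  have -> : pi_q q x = 0.
    apply/eqP; rewrite eq_le pi_ge0// andbT; apply: pi_le => // m.
    by elim: m => // m; rewrite preS /= => IH; rewrite add0r ler_pdivrMr// mul0r.
  move=> z0; apply/funext => j; apply: val_inj; apply/eqP; rewrite /= -leqn0 leqNgt.
  apply/negP => zj; have := qval_le_pi q1 z j.+1; rewrite z0 leNgt => /negP; apply.
  rewrite preSr -cats1 qval_cat ltr_wpDl ?qval_ge0//= addr0 !divr_gt0 ?exprn_gt0//.
  by rewrite ltr0n.
have : (0 < nwords n (pred1 (pre n x)))%N.
  elim: n => [//|n IH]; rewrite /nwords/= (bigD1 ord0)//= ltn_addr//.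
  apply: leq_trans IH _; apply: leq_wsum => w _; rewrite /= preS eqseq_cons eqxx.
  by [].
move=> /leq_trans; apply; apply: leq_nwords => w sw /eqP->; apply/asboolP.
by exists x; split=> //; exists 0%N; rewrite size_pre.
Qed.

End Expansions.

(** * Entropy *)

Section Entropy.
Variable R : realType.

(** Fekete's lemma; the limit is the infimum of u(n) / n over n >= 1. *)
Lemma subadditive_cvg (u : nat -> R) : u 0%N = 0 -> (forall n, 0 <= u n) ->
  (forall m n, u (m + n)%N <= u m + u n) ->
  exists2 l : R, (fun n => u n / n%:R) @ \oo --> l & forall n, n%:R * l <= u n.
Proof.
move=> u0 u_ge0 u_add.
pose S := [set u n.+1 / n.+1%:R | n in [set: nat]].
have S_inf : has_inf S.
  split; first by exists (u 1%N / 1%:R); exists 0%N.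
  by exists 0 => _ [n _ <-]; rewrite divr_ge0.
have lb n : n%:R * inf S <= u n.
  case: n => [|n]; first by rewrite u0 mul0r.
  rewrite mulrC -ler_pdivlMr ?ltr0n//; apply: ge_inf; first exact: S_inf.2.
  by exists n.
exists (inf S) => //; apply/cvgrPdist_le => e e0.
have [_ [N _ <-] uN] := inf_adherent (divr_gt0 e0 (ltr0Sn R 1)) S_inf.
set N1 := N.+1 in uN.
have u1 r : u r <= r%:R * u 1%N.
  elim: r => [|r IH]; first by rewrite u0 mul0r.
  by rewrite -addn1 natrD mulrDl mul1r; apply: le_trans (u_add _ _) _; rewrite lerD2r.
have uk k r : u (k * N1 + r)%N <= k%:R * u N1 + r%:R * u 1%N.
  elim: k => [|k IH]; first by rewrite mul0r add0r; exact: u1.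
  rewrite mulSn -addnA; apply: le_trans (u_add _ _) _.
  by rewrite -natr1 mulrDl mul1r [_ * _ + u _]addrC -addrA lerD2l.
have N10 : 0 < N1%:R :> R by rewrite ltr0n.
pose C := N1%:R * u 1%N.
have C0 : 0 <= C by rewrite mulr_ge0.
near=> n.
have nC : C / (e / 2) < n%:R.
  by near: n; exact: nbhs_infty_gtr.
have n0 : 0 < n%:R :> R.
  by apply: le_lt_trans nC; rewrite !divr_ge0// ltW.
rewrite distrC ger0_norm; last first.
  by rewrite subr_ge0 ler_pdivlMr// mulrC.
rewrite lerBlDr ler_pdivrMr//.
rewrite ltr_pdivrMr ?divr_gt0// in nC.
have h1 : u n <= (n %/ N1)%:R * u N1 + C.
  rewrite [X in u X](divn_eq n N1); apply: le_trans (uk _ _) _.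
  by rewrite lerD2l ler_wpM2r// ler_nat ltnW// ltn_pmod.
have h2 : (n %/ N1)%:R * u N1 <= n%:R * (u N1 / N1%:R).
  rewrite [leRHS]mulrCA [leRHS]mulrC ler_wpM2r// ler_pdivlMr//.
  by rewrite -natrM ler_nat leq_trunc_div.
have h3 : n%:R * (u N1 / N1%:R) <= n%:R * (inf S + e / 2).
  by rewrite ler_pM2l// ltW.
move: h3; rewrite mulrDr mulrDl => h3; lra.
Unshelve. all: by end_near. Qed.

(** The limit is characterized as the largest exponent for a lower bound valid at every length, the
    form used for entropy from here on. *)
Lemma natr_submul_growth (V : nat -> nat) : V 0%N = 1%N -> (forall n, (0 < V n)%N) ->
  (forall m n, (V (m + n) <= V m * V n)%N) ->
  let h : R := limn (fun n => ln ((V n)%:R : R) / n%:R) in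
  [/\ 0 <= h, forall n, expR h ^+ n <= (V n)%:R &
  forall a, (forall n, expR a ^+ n <= (V n)%:R) -> a <= h].
Proof.
move=> V0 Vpos Vsub h.
have Vp n : 0 < (V n)%:R :> R by rewrite ltr0n.
have lnV0 n : 0 <= ln (V n)%:R :> R by rewrite ln_ge0// ler1n.
have [||l lcvg lP] := @subadditive_cvg (fun n => ln (V n)%:R) _ lnV0.
- by rewrite V0 ln1.
- by move=> m n; rewrite -lnM ?posrE// ler_ln ?posrE ?mulr_gt0// -natrM ler_nat.
have hl : h = l by exact: cvg_lim.
have growth (a : R) n : (expR a ^+ n <= (V n)%:R) = (n%:R * a <= ln (V n)%:R).
  by rewrite -[RHS]ler_expR lnK ?posrE// expRM_natl.
have ub (a : R) : (forall n, expR a ^+ n <= (V n)%:R) -> a <= h.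
  move=> ha; rewrite hl -(cvg_lim _ lcvg)//; apply: limr_ge.
    by apply/cvg_ex; exists l.
  near=> n; have n0 : (0 < n)%N by near: n; exact: nbhs_infty_gt.
  by rewrite ler_pdivlMr ?ltr0n// mulrC -growth.
split => //.
- by apply: ub => n; rewrite expR0 expr1n ler1n.
- by move=> n; rewrite growth hl.
Unshelve. all: by end_near. Qed.

Variable M : nat.

Lemma entropy_univoque (q : R) : 1 < q -> let h := entropy R (symbolic_univoque M q) in
  [/\ 0 <= h,
  forall n, expR h ^+ n <= (nwords n (block (symbolic_univoque M q)))%:R &
  forall a, (forall n, expR a ^+ n <= (nwords n (block (symbolic_univoque M q)))%:R) ->
    a <= h].
Proof.
move=> q1; rewrite /entropy; under eq_fun do rewrite card_blocks.
apply: natr_submul_growth.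
- have := block_univoque_gt0 M 0 q1; rewrite /nwords/=.
  by case: (block _ _).
- by move=> n; exact: block_univoque_gt0.
- by move=> m n; apply: nwords_submul => u v; exact: block_cat.
Qed.

End Entropy.

Theorem theorem1p1 (R : realType) (M : nat) (hM : (1 <= M)%N) :
  {within `]1, M.+1%:R], continuous
    (fun q : R => entropy R (symbolic_univoque M q))}.
Proof.
apply/subspace_continuousP => q; rewrite /= in_itv/= => q1M.
have /andP[q1 _] := q1M.
have [h0 hg hmax] := entropy_univoque M q1.
set h := entropy _ _ in h0 hg hmax *.
have q0 : 0 < q by lra.
apply/cvgrPdist_le => e e0.
(* Growth h - e already occurs for admissible words in some base below [q]; these are blocks for
   every larger base, hence near [q] on both sides. *)
have lower : \forall p \near q, 1 < p -> h - e <= entropy R (symbolic_univoque M p).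
  have [he|eh] := leP h e.
    near=> p => p1; have [p0 _ _] := entropy_univoque M p1; lra.
  have adm_q : forall n, expR h ^+ n <= (nwords n (@adm R M q))%:R.
    by apply: univoque_growth_adm => //; rewrite expR_gt1; lra.
  have [|p /andP[p1 pq] hp] := @adm_growth_below R M q (expR h) (expR (h - e)) hM q1 _ adm_q.
    by rewrite expR_gt1 ltr_expR; apply/andP; split; lra.
  near=> p' => p'1; have [_ _] := entropy_univoque M p'1; apply.
  apply: (@adm_growth_univoque R M p p') hp; last exact: expR_gt0.
  by rewrite p1/=; near: p'; exact: lt_nbhsr.
have upper : \forall p \near q, 1 < p <= M.+1%:R ->
    entropy R (symbolic_univoque M p) <= h + e.
  (* Otherwise admissible words in a base below [q] grow at rate h + e / 2, and as blocks at [q]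
     they contradict the maximality of [h]. The inequality at this single [n] persists for nearby
     bases. *)
  have [n hn] : exists n, (nwords n (@adm R M q))%:R < expR (h + e) ^+ n.
    apply: contrapT => nn.
    have adm_q n : expR (h + e) ^+ n <= (nwords n (@adm R M q))%:R.
      by rewrite leNgt; apply/negP => lt; apply: nn; exists n.
    have [|p pq hp] :=
        @adm_growth_below R M q (expR (h + e)) (expR (h + e / 2)) hM q1 _ adm_q.
      by rewrite expR_gt1 ltr_expR; apply/andP; split; lra.
    have := hmax _ (adm_growth_univoque pq (expR_gt0 _) hp); lra.
  near=> p => p1M; have /andP[p1 _] := p1M.
  have [_ pg _] := entropy_univoque M p1.
  rewrite leNgt; apply/negP => lt.
  have : expR (h + e) ^+ n <= (nwords n (@adm R M p))%:R.
    apply: univoque_growth_adm => // [|m]; first by rewrite expR_gt1; lra.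
    apply: le_trans (pg m); apply: lerXn2r; rewrite ?nnegrE ?expR_ge0//.
    by rewrite ler_expR ltW.
  apply/negP; rewrite -ltNge; apply: le_lt_trans hn; rewrite ler_nat.
  by near: p; exact: nwords_adm_near.
rewrite near_withinE; near=> p; rewrite /= in_itv/= => p1M.
have /andP[p1 _] := p1M.
have hl : h - e <= entropy R (symbolic_univoque M p) by move: p1; near: p.
have hu : entropy R (symbolic_univoque M p) <= h + e by move: p1M; near: p.
by rewrite ler_distlC; apply/andP.
Unshelve. all: by end_near. Qed.
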